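(* Assume that $\ln L\geq 1$. Given levels $\alpha$ and $\beta$ in $]0,1[$, let $\Phi_{\alpha}^{(2)}$ be the second test (defined in the context) with $\bar{J}=\lfloor\log_2(L/\ln L)\rfloor$. Let $R,R',R''>0$. For every $\delta>0$ and $\gamma>0$, there exists some positive constant $C(\alpha,\beta,R'',\delta,\gamma)$ such that if $s$ belongs to $\mathcal{B}_{2,\infty}^\delta(R)\cap W_\gamma(R')\cap\mathbb{L}^{\infty}(R'')$ and satisfies $$d^2(s,\mathcal{S}_0)> C(\alpha,\beta,R'',\delta,\gamma) \left(\frac{\ln L}{L}+ R^2 \left(\frac{\ln L}{L}\right)^{2\delta}+R'^2 \left(\frac{\ln L}{L}\right)^{\frac{2\gamma}{1+2\gamma}}+R'^{2+4\gamma}\left(\frac{\ln L}{L}\right)^{2\gamma}\right),$$ then $\mathbb{P}_s(\Phi_{\alpha}^{(2)}=0)\leq \beta$. In particular, when $\delta\geq \gamma/(1+2\gamma)$, there exist some positive constants $L_0(\delta,\gamma)$ and $C(\alpha,\beta,R,R',R'',\delta,\gamma)$ such that if $L>L_0(\delta,\gamma)$, then $$\rho(\Phi_\alpha^{(2)},\mathcal{B}_{2,\infty}^\delta(R)\cap W_\gamma(R')\cap \mathbb{L}^\infty(R''),\beta)\leq C(\alpha,\beta,R,R',R'',\delta,\gamma)\left(\frac{\ln L}{L}\right)^{\frac{\gamma}{1+2\gamma}}.$$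
   Context: A constant written $C(a,b,\dots)$ or $L_0(a,\dots)$ depends only on the listed parameters (in particular not on $L$ or $s$). Setting. One observes a Poisson process $N$ on $[0,1]$ with intensity $s\ge0$, $s\in\mathbb{L}^2([0,1])$, with respect to $d\mu(x)=L\,dx$ (mean measure $L s(x)dx$); $\mathbb{P}_s$ is its distribution, $X_1,\dots,X_{N_L}$ its points, $N_L$ their number. $\|\cdot\|,\langle\cdot,\cdot\rangle,d$ are the norm, scalar product and distance of $\mathbb{L}^2([0,1],dx)$; $\mathcal{S}_0$ is the set of constant functions on $[0,1]$. Haar basis: $\phi_0=\mathbf{1}_{[0,1]}$, $\phi_{(j,k)}(x)=2^{j/2}\psi(2^jx-k)$, $j\in\mathbb{N}$, $0\le k\le 2^j-1$, $\psi=\mathbf{1}_{[0,1/2[}-\mathbf{1}_{[1/2,1[}$; $\alpha_{(j,k)}=\langle s,\phi_{(j,k)}\rangle$. For $\bar J\ge1$, $\Lambda_{\bar J}=\{(j,k): 0\le j\le \bar J-1,\ 0\le k\le 2^j-1\}$. Classes: $\mathcal{B}_{2,\infty}^\delta(R)=\{s\ge0,\ s\in\mathbb{L}^2([0,1]):\forall j\in\mathbb{N},\ \sum_{k=0}^{2^j-1}\alpha_{(j,k)}^2\le R^22^{-2j\delta}\}$; $W_\gamma(R')=\{s\ge0,\ s\in\mathbb{L}^2([0,1]):\forall t>0,\ \sum_{j\in\mathbb{N}}\sum_{k=0}^{2^j-1}\alpha_{(j,k)}^2\mathbf{1}_{\alpha_{(j,k)}^2\le t}\le R'^2t^{2\gamma/(1+2\gamma)}\}$;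 $\mathbb{L}^\infty(R'')$ is the set of functions bounded by $R''$. Uniform separation rate: $\rho(\Phi,\mathcal{S}_1,\beta)=\inf\{\rho>0:\ \sup_{s\in\mathcal{S}_1,\,d(s,\mathcal{S}_0)>\rho}\mathbb{P}_s(\Phi=0)\le\beta\}$. Second test. For $\lambda=(j,k)$ let $T_\lambda=\frac1{L^2}\sum_{l\ne l'=1}^{N_L}\phi_\lambda(X_l)\phi_\lambda(X_{l'})$. Under the null hypothesis $s\in\mathcal{S}_0$, conditionally on $N_L=n$, the points are $n$ i.i.d. uniform variables on $[0,1]$, so the conditional law of $(T_\lambda)_\lambda$ does not depend on $s\in\mathcal{S}_0$. For $u\in]0,1[$, $q_\lambda^{(n)}(u)$ is the $(1-u)$ quantile of $T_\lambda$ given $N_L=n$ under the null hypothesis. Given an integer $\bar J\ge1$, set $$u_\alpha^{(n)}=\sup\Big\{u\in]0,1[:\ \sup_{s\in\mathcal{S}_0}\mathbb{P}_s\Big(\sup_{(j,k)\in\Lambda_{\bar J}}\Big(T_{(j,k)}-q_{(j,k)}^{(n)}\Big(\frac{u}{2^j\bar J}\Big)\Big)>0\,\Big|\,N_L=n\Big)\le\alpha\Big\},$$ $u_{(j,k),\alpha}^{(n)}=u_\alpha^{(n)}/(2^j\bar J)$, $\mathcal{T}_\alpha^{(2)}=\sup_{\lambda\in\Lambda_{\bar J}}\big(T_\lambda-q_\lambda^{(N_L)}(u_{\lambda,\alpha}^{(N_L)})\big)$ and $\Phi_\alpha^{(2)}=\mathbf{1}_{\mathcal{T}_\alpha^{(2)}>0}$.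 *)

(* Defs.v *)
From HB Require Import structures.
From mathcomp Require Export all_boot all_order all_algebra.
From mathcomp Require Export all_classical all_reals all_analysis.

Set Implicit Arguments.
Unset Strict Implicit.
Unset Printing Implicit Defensive.

Import Order.TTheory GRing.Theory Num.Theory.
Import numFieldNormedType.Exports.

Local Open Scope classical_set_scope.
Local Open Scope ring_scope.

Section L2.
Context {R : realType}.
Implicit Types (s t : R -> R).

(* Functions on [0,1] are represented by functions on R; all the notions below
   only look at their values on I01. *)
Definition I01 : set R := `[0, 1].

Definition in_L2 s : Prop :=
  measurable_fun I01 s /\
  (@lebesgue_measure R).-integrable I01 (fun x => (s x ^+ 2)%:E).

Definition inner s t : R := \int[lebesgue_measure]_(x in I01) (s x * t x).

Definition norm2 s : R := Num.sqrt (inner s s).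

Definition dist2 s t : R := norm2 (fun x => s x - t x).

Definition dist2_set s (S : set (R -> R)) : R := inf [set dist2 s t | t in S].

(* No sign condition: intersect with [intensity] to get null intensities. *)
Definition S0 : set (R -> R) :=
  [set s | exists c : R, forall x, I01 x -> s x = c].

Definition intensity : set (R -> R) :=
  [set s | in_L2 s /\ forall x, I01 x -> 0 <= s x].

End L2.

Section Haar.
Context {R : realType}.
Implicit Types (s : R -> R) (lam : nat * nat) (gamma delta Rad : R).

Definition psi (x : R) : R :=
  \1_(`[0, 2^-1[ : set R) x - \1_(`[2^-1, 1[ : set R) x.

Definition haar lam (x : R) : R :=
  2 `^ (lam.1%:R / 2) * psi (2 ^+ lam.1 * x - lam.2%:R).

Definition coef s lam : R := inner s (haar lam).

Definition Lambda (J : nat) : set (nat * nat) :=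
  [set lam | (lam.1 < J)%N /\ (lam.2 < 2 ^ lam.1)%N].

Definition besov delta Rad : set (R -> R) :=
  [set s | intensity s /\
     forall j : nat, \sum_(k < 2 ^ j) coef s (j, val k) ^+ 2
                       <= Rad ^+ 2 * 2 `^ (- (2 * j%:R * delta))].

Definition weak_besov gamma Rad : set (R -> R) :=
  [set s | intensity s /\
     forall t : R, 0 < t ->
       (\sum_(0 <= j <oo)
          (\sum_(k < 2 ^ j)
             coef s (j, val k) ^+ 2 * (coef s (j, val k) ^+ 2 <= t)%R%:R)%:E
        <= (Rad ^+ 2 * t `^ (2 * gamma / (1 + 2 * gamma)))%:E)%E].

Definition bounded_by Rad : set (R -> R) :=
  [set s | forall x, I01 x -> `|s x| <= Rad].

End Haar.

Section Poisson.
Context {R : realType} {d : measure_display} {Omega : measurableType d}.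
Implicit Types (Q : probability Omega R) (N : Omega -> nat)
  (X : nat -> Omega -> R) (P : (R -> R) -> probability Omega R).

(* A finite point process is given by its number of points [N w] and its points
   [X 0 w, ..., X (N w).-1 w]; the values [X i w] for [N w <= i] are irrelevant
   and the order of the points is unspecified. *)
Definition count_in N X (A : set R) (w : Omega) : nat :=
  \sum_(i < N w) (X i w \in A).

Definition point_process N X : Prop :=
  [/\ measurable_fun setT N,
      forall i, measurable_fun [set w | (i < N w)%N] (X i) &
      forall w i, (i < N w)%N -> I01 (X i w)].

(* The second argument of [poisson_prob] is a dummy; unlike [poisson_pmf],
   [poisson_prob] is correct at rate 0 (Dirac mass at 0). *)
Definition poisson_process Q N X (nu : set R -> R) : Prop :=
  [/\ point_process N X,
      forall A, measurable A -> A `<=` I01 ->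
        forall B : set nat,
          Q [set w | B (count_in N X A w)] = poisson_prob (nu A) 0 B &
      forall (m : nat) (A : 'I_m -> set R),
        (forall i, measurable (A i) /\ A i `<=` I01) ->
        trivIset setT A ->
        forall B : 'I_m -> set nat,
          fine (Q [set w | forall i, B i (count_in N X (A i) w)]) =
          \prod_(i < m) fine (Q [set w | B i (count_in N X (A i) w)])].

(* [P s] makes the observation (N, X) a Poisson process with intensity s with
   respect to L dx. *)
Definition poisson_model (L : R) N X P : Prop :=
  forall s, intensity s ->
    poisson_process (P s) N X
      (fun A => L * \int[lebesgue_measure]_(x in A) s x).

(* Equal to 0 when Q B = 0, since division by 0 gives 0. *)
Definition cprob Q (A B : set Omega) : R := fine (Q (A `&` B)) / fine (Q B).

Definition separation_rate P (Phi : Omega -> bool) (S1 : set (R -> R))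
    (beta : R) : \bar R :=
  ereal_inf [set rho%:E | rho in [set rho : R | 0 < rho /\
    (ereal_sup [set P s [set w | Phi w = false] |
                  s in S1 `&` [set s | (rho < dist2_set s S0)%R]]
     <= beta%:E)%E]].

End Poisson.

Section Test.
Context {R : realType} {d : measure_display} {Omega : measurableType d}.
Variables (L : R) (N : Omega -> nat) (X : nat -> Omega -> R).
Variables (P : (R -> R) -> probability Omega R) (J : nat) (alpha : R).
Implicit Types (lam : nat * nat) (n : nat) (u : R) (w : Omega).

Definition Tstat lam w : R :=
  (L ^+ 2)^-1 *
  \sum_(l < N w) \sum_(l' < N w | l' != l) haar lam (X l w) * haar lam (X l' w).

(* The conditional law given N = n is the same for all nonzero constant
   intensities, so it is read off at the constant intensity 1. *)
Definition null_cdf n lam (t : R) : R :=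
  cprob (P (cst 1)) [set w | Tstat lam w <= t] [set w | N w = n].

Definition qlam n lam u : R := inf [set t : R | 1 - u <= null_cdf n lam t].

Definition Tsup n u w : R :=
  sup [set Tstat lam w - qlam n lam (u / (2 ^+ lam.1 * J%:R)) |
         lam in Lambda J].

(* The zero intensity, for which conditioning on N = n > 0 is undefined, does
   not affect the inner supremum, by the convention in [cprob]. *)
Definition u_alpha n : R :=
  sup [set u : R | 0 < u < 1 /\
    sup [set cprob (P s) [set w | 0 < Tsup n u w] [set w | N w = n] |
           s in S0 `&` intensity] <= alpha].

Definition T2 w : R := Tsup (N w) (u_alpha (N w)) w.

Definition Phi2 w : bool := 0 < T2 w.

End Test.

Definition Jbar {R : realType} (L : R) : nat :=
  Num.truncn (ln (L / ln L) / ln 2).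

(* Main.v *)
(* Each T_lam is 2^j / L^2 ((A - B)^2 - (A + B)), where A and B count the points in
   the two halves of a dyadic cell. Given N = n under the null hypothesis, A and B
   are two coordinates of a trinomial law, so a Chernoff bound shows that every
   critical value used by the test is at most of order (ln L / L) (1 + n / L); here
   Bonferroni's inequality gives u_alpha >= alpha. Under an arbitrary intensity,
   Chebyshev's inequality for A, B and N shows that a single lam with
   coef s lam ^+ 2 > K ln L / L is detected with probability at least 1 - beta. So
   if the power is smaller, all coefficients up to level Jbar are below the
   threshold K ln L / L, and Parseval's identity bounds d^2 (s, S0) by the weak
   Besov condition at this threshold plus the Besov tail beyond level Jbar. Only
   the second and third terms of the separation bound are needed. *)

From mathcomp Require Import measurable_realfun ring lra.
Require Import Defs.

Set Implicit Arguments.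
Unset Strict Implicit.
Unset Printing Implicit Defensive.

Import Order.TTheory GRing.Theory Num.Theory.
Import numFieldNormedType.Exports.

Local Open Scope classical_set_scope.
Local Open Scope ring_scope.

(** * Poisson and trinomial tails *)

Section PoissonTail.
Context {R : realType}.
Implicit Types (r v : R) (k n : nat).

(** Bonferroni's inequality reduces the calibration to one [lam] at a time, so the only null law
    ever computed is that of two cell counts given N. The levels u / (2^j Jbar) sum to u over
    [Lambda Jbar], and the logarithms of their inverses stay of order ln L because 2^Jbar <= L. The
    choice of Jbar enters twice. From above, 2^j <= L / ln L makes the scale L 2^-j of the expected
    counts at least ln L; the quadratic term l^2 of the Chernoff bound, with l of order ln L, is
    then absorbed into L 2^-j ln L, the order of the squared differences of counts that can be
    detected. From below, 2^(Jbar + 1) > L / ln L bounds the Besov tail at the cost of a factor 2^(2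
    delta). The sup bound on s keeps the variances of A and B of order L 2^-j, so that Chebyshev's
    inequality is enough for the power. It also supplies the dominating function for Parseval's
    identity, which is obtained by Lebesgue differentiation along dyadic cells. *)

Lemma poisson_prob1 r k : 0 <= r ->
  poisson_prob r 0 [set k] = (r ^+ k / k`!%:R * expR (- r))%:E.
Proof.
rewrite le0r => /orP[/eqP->|r0]; rewrite /poisson_prob.
  rewrite ltxx diracE oppr0 expR0 mulr1.
  case: k => [|k]; first by rewrite expr0 fact0 divr1 mem_set.
  by rewrite expr0n mul0r memNset.
rewrite r0 esum_set1 ?lee_fin ?poisson_pmf_ge0//.
by rewrite /poisson_pmf r0.
Qed.

(** The truncated variance has a closed form: its defect from [r] times the truncated mass is a
    boundary term, nonpositive once [r <= n]. Chebyshev's inequality can then be proved on finite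
    sums. *)
Lemma sum_sqr_dev_poisson r n :
  \sum_(k < n) (k%:R - r) ^+ 2 * (r ^+ k / k`!%:R) =
  r * \sum_(k < n) (r ^+ k / k`!%:R) + n%:R * (r - n%:R) * (r ^+ n / n`!%:R).
Proof.
elim: n => [|n IH]; first by rewrite !big_ord0 mulr0 !mul0r addr0.
have fS : r ^+ n.+1 / n.+1`!%:R = r / n.+1%:R * (r ^+ n / n`!%:R).
  by rewrite factS natrM exprS invfM; ring.
rewrite !big_ord_recr/= IH fS -natr1.
have : n%:R + 1 != 0 :> R by rewrite natr1 pnatr_eq0.
by move: (r ^+ n / _) => t nz; field.
Qed.

Lemma sum_sqr_dev_poisson_le r n : 0 <= r ->
  \sum_(k < n) (k%:R - r) ^+ 2 * (r ^+ k / k`!%:R) <= r * expR r.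
Proof.
move=> r0.
have t0 k : 0 <= r ^+ k / k`!%:R by rewrite divr_ge0 ?exprn_ge0.
(* The summands are nonnegative, so the sum may be lengthened until its length exceeds [r], where
   the boundary term has the right sign. *)
pose m := maxn n (Num.truncn r).+1.
have rm : r <= m%:R.
  by rewrite (le_trans (ltW (truncnS_gt r)))// ler_nat leq_maxr.
apply: (@le_trans _ _ (\sum_(k < m) (k%:R - r) ^+ 2 * (r ^+ k / k`!%:R))).
  rewrite -!(big_mkord predT (fun k => (k%:R - r) ^+ 2 * (r ^+ k / k`!%:R))).
  rewrite [leRHS](big_cat_nat _ (n := n)) ?leq_maxl//= lerDl.
  by rewrite sumr_ge0// => k _; rewrite mulr_ge0 ?sqr_ge0.
rewrite sum_sqr_dev_poisson -[leRHS]addr0 lerD//.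
  rewrite ler_wpM2l//.
  rewrite -(big_mkord predT (fun k => r ^+ k / k`!%:R)).
  apply: (nondecreasing_cvgn_le _ (is_cvg_series_exp_coeff r) m).
  by apply: nondecreasing_series => k _ _; exact: t0.
by rewrite mulr_le0_ge0// mulr_ge0_le0// subr_le0.
Qed.

Lemma poisson_chebyshev r v : 0 <= r -> 0 < v ->
  (poisson_prob r 0 [set k | (v <= `|k%:R - r|)%R] <= (r / v ^+ 2)%:E)%E.
Proof.
rewrite le0r => /orP[/eqP->|r0] v0; rewrite /poisson_prob.
  rewrite ltxx diracE mul0r memNset//= subr0 normr0 => /(lt_le_trans v0).
  by rewrite ltxx.
rewrite r0; set U := [set k | _].
have pmf0 k : (0 <= (poisson_pmf r k)%:E)%E by rewrite lee_fin poisson_pmf_ge0.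
rewrite -[X in esum X](set_mem_set U) -nneseries_esum//.
apply: lime_le; first exact: is_cvg_nneseries.
apply: nearW => n; rewrite sumEFin lee_fin.
rewrite ler_pdivlMr ?exprn_gt0// mulrC mulr_sumr.
apply: (@le_trans _ _ (expR (- r) *
    \sum_(k < n) (k%:R - r) ^+ 2 * (r ^+ k / k`!%:R))); last first.
  apply: le_trans
    (ler_wpM2l (expR_ge0 (- r)) (sum_sqr_dev_poisson_le n (ltW r0))) _.
  by rewrite mulrCA expRN mulVf ?mulr1// gt_eqF ?expR_gt0.
rewrite mulr_sumr big_mkord [leRHS](bigID (fun k : 'I_n => val k \in U))/=.
rewrite -[leLHS]addr0 lerD//; last first.
  rewrite sumr_ge0// => k _; rewrite mulr_ge0 ?expR_ge0// mulr_ge0 ?sqr_ge0//.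
  by rewrite divr_ge0// exprn_ge0// ltW.
apply: ler_sum => k; rewrite inE/= => vk.
rewrite /poisson_pmf r0 mulrA mulrC ler_wpM2l ?expR_ge0// ler_wpM2r//.
  by rewrite divr_ge0// exprn_ge0// ltW.
by rewrite -(real_normK (num_real (_ - r))) lerXn2r ?nnegrE// ltW.
Qed.

End PoissonTail.

Section Trinomial.
Context {R : realType}.
Implicit Types (p u th : R) (G : nat -> nat -> bool) (n : nat).

(* The probability of G a b when (a, b, n - a - b) is multinomial with cell
   probabilities p / 2, p / 2, 1 - p; the outer index is i = a + b. *)
Definition trinomial n p G : R :=
  \sum_(i < n.+1) \sum_(a < i.+1)
    ('C(n, i) * 'C(i, a))%:R * (p / 2) ^+ i * (1 - p) ^+ (n - i) *
    (G a (i - a)%N)%:R.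

Lemma trinomial_le n p G G' : 0 <= p <= 1 ->
  (forall a b, (a + b <= n)%N -> G a b -> G' a b) ->
  trinomial n p G <= trinomial n p G'.
Proof.
move=> /andP[p0 p1] GG'; apply: ler_sum => i _; apply: ler_sum => a _.
rewrite ler_wpM2l//.
  by rewrite !mulr_ge0 ?exprn_ge0 ?divr_ge0 ?subr_ge0.
have /GG' : (a + (i - a) <= n)%N by rewrite subnKC leq_ord.
by case: (G _ _); case: (G' _ _) => // /(_ isT).
Qed.

Lemma trinomial_expand n (x y z : R) :
  \sum_(i < n.+1) \sum_(a < i.+1)
    ('C(n, i) * 'C(i, a))%:R * (x ^+ a * y ^+ (i - a)) * z ^+ (n - i)
  = (x + y + z) ^+ n.
Proof.
rewrite [x + y + z]addrC exprDn; apply: eq_bigr => i _.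
rewrite [x + y]addrC exprDn mulrC -mulrnAl -mulr_suml; congr (_ * _).
rewrite -sumrMnl; apply: eq_bigr => a _.
by rewrite -mulrnA mulrC mulr_natr mulnC [x ^+ _ * _]mulrC.
Qed.

Lemma trinomial_true n p : trinomial n p (fun _ _ => true) = 1.
Proof.
rewrite -[RHS](expr1n _ n) -[1 in RHS](_ : p / 2 + p / 2 + (1 - p) = 1).
  rewrite -trinomial_expand; apply: eq_bigr => i _; apply: eq_bigr => a _.
  by rewrite mulr1 -exprD subnKC ?leq_ord.
by rewrite -splitr addrC subrK.
Qed.

Lemma trinomialN n p G :
  trinomial n p (fun a b => ~~ G a b) = 1 - trinomial n p G.
Proof.
rewrite -(trinomial_true n p) /trinomial -sumrB; apply: eq_bigr => i _.
rewrite -sumrB; apply: eq_bigr => a _.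
by case: (G _ _); rewrite /= ?mulr1 ?mulr0 ?subrr ?subr0.
Qed.

(** Applying [expR y <= 1 / (1 - y)] at [th] and [- th] bounds the average by [1 / (1 - th ^+ 2)],
    which is at most [1 + 2 * th ^+ 2] as long as [th ^+ 2 <= 1 / 2]. *)
Lemma coshR_le th : th ^+ 2 <= 2^-1 ->
  expR th / 2 + expR (- th) / 2 <= 1 + 2 * th ^+ 2.
Proof.
move=> th2.
have lt1 : -1 < th < 1 by apply/andP; split; nra.
have H (y : R) : y < 1 -> expR y <= (1 - y)^-1.
  move=> y1; rewrite -[y in expR y]opprK expRN lef_pV2 ?posrE ?subr_gt0//.
    exact: expR_ge1Dx.
  exact: expR_gt0.
have /andP[l1 l2] := lt1.
have e1 := H th l2; have e2 := H (- th) ltac:(lra).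
apply: (le_trans (y := (1 - th)^-1 / 2 + (1 - - th)^-1 / 2)); first lra.
have -> : (1 - th)^-1 / 2 + (1 - - th)^-1 / 2 = (1 - th ^+ 2)^-1.
  by field; rewrite !subr_eq0 !gt_eqF//=; nra.
rewrite -[leLHS]mul1r ler_pdivrMr; nra.
Qed.

(** The left-hand side is the moment generating function of [a - b], that is [1 + p (cosh th - 1)]
    to the power [n]; conclude by [coshR_le] and [1 + y <= expR y]. *)
Lemma trinomial_mgf_le n p th : 0 <= p <= 1 -> th ^+ 2 <= 2^-1 ->
  \sum_(i < n.+1) \sum_(a < i.+1)
    ('C(n, i) * 'C(i, a))%:R * (p / 2) ^+ i * (1 - p) ^+ (n - i) *
    expR (th * (a%:R - (i - a)%N%:R))
  <= expR (2 * n%:R * p * th ^+ 2).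
Proof.
move=> /andP[p0 p1] th2.
have -> : expR (2 * n%:R * p * th ^+ 2) = expR (2 * p * th ^+ 2) ^+ n.
  by rewrite -expRM_natl; congr expR; ring.
rewrite [leLHS](_ : _ =
    (p / 2 * expR th + p / 2 * expR (- th) + (1 - p)) ^+ n); last first.
  rewrite -trinomial_expand; apply: eq_bigr => i _; apply: eq_bigr => a _.
  rewrite !(exprMn _ _ (expR _)) -!expRM_natl.
  have -> : (p / 2) ^+ i = (p / 2) ^+ a * (p / 2) ^+ (i - a).
    by rewrite -exprD subnKC ?leq_ord.
  have -> : th * (a%:R - (i - a)%N%:R) = a%:R * th + (i - a)%N%:R * - th.
    by ring.
  by rewrite expRD; ring.
apply: lerXn2r; rewrite ?nnegrE ?expR_ge0//.
  by rewrite addr_ge0 ?subr_ge0// -mulrDr mulr_ge0 ?addr_ge0 ?expR_ge0 ?divr_ge0.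
apply: le_trans (expR_ge1Dx _).
have := coshR_le th2; nra.
Qed.

(* Chernoff's bound at th = sqrt (l / (2 (n p + l))), where l = ln (2 / u). *)
Lemma trinomial_tail n p u : 0 <= p <= 1 -> 0 < u < 2 ->
  trinomial n p (fun a b =>
    8 * ln (2 / u) * (n%:R * p + ln (2 / u)) < (a%:R - b%:R) ^+ 2) <= u.
Proof.
move=> /andP[p0 p1] /andP[u0 u2]; set l := ln _.
have l0 : 0 < l by rewrite ln_gt0// ltr_pdivlMr// mul1r.
have np0 : 0 <= n%:R * p by rewrite mulr_ge0.
set S := n%:R * p + l; have S0 : 0 < S by rewrite ltr_wpDl.
pose th := Num.sqrt (l / (2 * S)).
have th2 : th ^+ 2 = l / (2 * S) by rewrite sqr_sqrtr// divr_ge0 ?mulr_ge0 // ltW.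
have th_le : th ^+ 2 <= 2^-1.
  by rewrite th2 invfM mulrCA -[leRHS]mulr1 ler_wpM2l// ler_pdivrMr// mul1r lerDr.
have th0 : 0 <= th by exact: sqrtr_ge0.
(* Exponential Markov bound for both tails at once: on the event, the square of [th * (a - b)]
   exceeds [8 * l * S * th ^+ 2 = 4 * l ^+ 2], so one of the two exponentials is at least
   [expR (2 * l)]. *)
have ind (a b : nat) : (8 * l * S < (a%:R - b%:R) ^+ 2)%R%:R <=
    expR (- (2 * l)) * (expR (th * (a%:R - b%:R)) +
      expR (- th * (a%:R - b%:R))) :> R.
  case: ltP => [|_]; last by rewrite mulr_ge0 ?addr_ge0 ?expR_ge0.
  set d := a%:R - b%:R => dS.
  have td : 2 * l <= `|th * d|.
    rewrite -(@ler_pXn2r _ 2) ?nnegrE ?normr_ge0 ?mulr_ge0// ?(ltW l0)//.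
    rewrite real_normK ?num_real// [(th * d) ^+ 2]exprMn th2.
    rewrite mulrAC ler_pdivlMr ?mulr_gt0//.
    by move/ltW: dS; rewrite -(ler_pM2l l0); lra.
  rewrite mulrDr -!expRD mulNr.
  have [d0|d0] := lerP 0 (th * d); rewrite ?(ger0_norm d0) ?(ltr0_norm d0) in td.
    rewrite -[leLHS]addr0 lerD ?expR_ge0// -[leLHS]expR0 ler_expR; lra.
  rewrite -[leLHS]add0r lerD ?expR_ge0// -[leLHS]expR0 ler_expR; lra.
rewrite /trinomial.
have mg1 := trinomial_mgf_le n (th := th) (p := p) ltac:(by rewrite p0 p1) th_le.
have mg2 := trinomial_mgf_le n (th := - th) (p := p) ltac:(by rewrite p0 p1)
  ltac:(by rewrite sqrrN).
rewrite sqrrN in mg2.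
apply: (@le_trans _ _ (expR (- (2 * l)) * (expR (2 * n%:R * p * th ^+ 2) +
    expR (2 * n%:R * p * th ^+ 2)))).
  apply: (le_trans _ (ler_wpM2l (expR_ge0 _) (lerD mg1 mg2))).
  rewrite -big_split/= mulr_sumr; apply: ler_sum => i _.
  rewrite -big_split/= mulr_sumr; apply: ler_sum => a _.
  rewrite -mulrDr mulrCA ler_wpM2l ?ind//.
  by rewrite !mulr_ge0 ?exprn_ge0 ?divr_ge0 ?subr_ge0.
(* The exponent [2 * n * p * th ^+ 2 = l * n * p / S] is at most [l], so each tail contributes at
   most [expR (- l) = u / 2]. *)
have : expR (- (2 * l)) * expR (2 * n%:R * p * th ^+ 2) <= expR (- l).
  rewrite -expRD ler_expR th2.
  suff : 2 * n%:R * p * (l / (2 * S)) <= l by lra.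
  rewrite mulrA ler_pdivrMr ?mulr_gt0// /S; nra.
have -> : expR (- l) = u / 2.
  by rewrite expRN lnK ?posrE ?divr_gt0// invf_div.
lra.
Qed.

End Trinomial.

(** * Counts of a Poisson process *)

Section Counting.
Context {R : realType} {d : measure_display} {Omega : measurableType d}.
Implicit Types (Q : probability Omega R) (f g : Omega -> nat).

Definition measurable_nat f : Prop := forall k, measurable [set w | f w = k].

Lemma measurable_nat_pair f g (P : nat -> nat -> Prop) :
  measurable_nat f -> measurable_nat g -> measurable [set w | P (f w) (g w)].
Proof.
move=> mf mg; rewrite (_ : [set w | _] = \bigcup_a \bigcup_(b in [set b | P a b])
    ([set w | f w = a] `&` [set w | g w = b])).
  by apply: bigcupT_measurable => a; apply: bigcup_measurable => b _;
    apply: measurableI.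
apply/seteqP; split => [w Pw|w [a _ [b /= Pab [/= fa gb]]]]/=.
  by exists (f w) => //; exists (g w).
by rewrite fa gb.
Qed.

Lemma measurable_nat_op f g (op : nat -> nat -> nat) :
  measurable_nat f -> measurable_nat g -> measurable_nat (fun w => op (f w) (g w)).
Proof.
by move=> mf mg k; exact: (measurable_nat_pair (fun a b => op a b = k)).
Qed.

Lemma fine_measure_partition Q f (m : nat) (E : set Omega) :
  measurable_nat f -> measurable E -> (forall w, E w -> (f w < m)%N) ->
  fine (Q E) = \sum_(i < m) fine (Q (E `&` [set w | f w = i])).
Proof.
move=> mf mE Em; pose F i := E `&` [set w | f w = i].
have mF i : measurable (F i) by exact: measurableI.
rewrite -[E in LHS](_ : \big[setU/set0]_(i < m) F i = E).
  rewrite measure_bigsetU//; last first.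
    apply/trivIsetP => i j _ _ /eqP ij; rewrite -subset0.
    by move=> w [[_ /= fi] [_ /= fj]]; apply: ij; rewrite -fi.
  by rewrite -sum_fine// => i _; exact: fin_num_measure.
rewrite -bigcup_mkord; apply/seteqP; split => [w [i _ []//]|w Ew].
by exists (f w) => //; exact: Em.
Qed.

Variables (N : Omega -> nat) (X : nat -> Omega -> R).
Hypothesis ppX : point_process N X.

(** Each [X i] is measurable only on the event [i < N], hence the sets [E i]; the number of summands
    is random, hence the partition by the value of [N]. *)
Lemma measurable_count (A : set R) :
  measurable A -> measurable_nat (count_in N X A).
Proof.
case: ppX => mN mX _ mA.
pose E i := [set w | (i < N w)%N] `&` X i @^-1` A.
have mE i : measurable (E i).
  apply: mX => //; rewrite (_ : [set w | _] = N @^-1` [set k | (i < k)%N])//.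
  by rewrite -[X in measurable X]setTI; exact: mN.
have mS n : measurable_nat (fun w => \sum_(i < n) (w \in E i))%N.
  elim: n => [|n IH] k.
    case: k => [|k]; [rewrite (_ : [set w | _] = setT)//|
      rewrite (_ : [set w | _] = set0)//].
      by apply/seteqP; split => // w _ /=; rewrite big_ord0.
    by rewrite -subset0 => w /=; rewrite big_ord0.
  under eq_set do rewrite big_ord_recr/=.
  apply: (measurable_nat_op addn IH) => j.
  rewrite (_ : [set w | _] = if j == 1%N then E n else if j == 0%N then ~` E n
    else set0).
    by case: eqP => _//; case: eqP => _//; exact: measurableC.
  apply/seteqP; split => w/=; first by
    case: (boolP (w \in E n)) => [|/negP] h <-/=; rewrite inE in h.
  case: eqP => [->|_]; first by move=> h; rewrite mem_set.
  by case: eqP => [->|//]; move=> h; rewrite memNset.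
move=> k; rewrite (_ : [set w | _] = \bigcup_n ([set w | N w = n] `&`
    [set w | (\sum_(i < n) (w \in E i))%N = k])).
  apply: bigcupT_measurable => n; apply: measurableI; last exact: mS.
  rewrite (_ : [set w | _] = N @^-1` [set n])//.
  by rewrite -[X in measurable X]setTI; exact: mN.
have eqC w : count_in N X A w = (\sum_(i < N w) (w \in E i))%N.
  apply: eq_bigr => i _; congr nat_of_bool; apply/idP/idP; rewrite !inE.
    by split => //=; exact: ltn_ord.
  by case.
by apply/seteqP; split => [w/=|w [n _ [/= <-]]]; rewrite eqC//; exists (N w).
Qed.

Lemma measurable_N : measurable_nat N.
Proof.
case: ppX => mN _ _ n; rewrite (_ : [set w | _] = N @^-1` [set n])//.
by rewrite -[X in measurable X]setTI; exact: mN.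
Qed.

Lemma count_in_I01 w : count_in N X I01 w = N w.
Proof.
rewrite /count_in (eq_bigr (fun=> 1%N)) ?sum1_card ?card_ord// => i _.
by rewrite mem_set//; case: ppX => _ _; apply.
Qed.

Lemma count_inU (A B : set R) w : A `&` B = set0 ->
  count_in N X (A `|` B) w = (count_in N X A w + count_in N X B w)%N.
Proof.
move=> AB; rewrite /count_in -big_split/=; apply: eq_bigr => i _.
have [XA|XA] := boolP (X i w \in A); have [XB|XB] := boolP (X i w \in B);
  rewrite ?in_setU ?XA ?(negbTE XA) ?XB ?(negbTE XB)//.
suff : (A `&` B) (X i w) by rewrite AB.
by split; apply: set_mem.
Qed.

End Counting.

(** * The law of two cell counts jointly with the total count *)

Section NullLaw.
Context {R : realType} {d : measure_display} {Omega : measurableType d}.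
Variables (Q : probability Omega R) (N : Omega -> nat) (X : nat -> Omega -> R).
Variable nu : set R -> R.
Hypothesis ppQ : poisson_process Q N X nu.

Lemma poisson_process_count1 (A : set R) k :
  measurable A -> A `<=` I01 -> 0 <= nu A ->
  fine (Q [set w | count_in N X A w = k]) =
  nu A ^+ k / k`!%:R * expR (- nu A).
Proof.
move=> mA AI nu0; case: ppQ => _ /(_ A mA AI [set k])/= -> _.
by rewrite poisson_prob1.
Qed.

Lemma poisson_process_N n : 0 <= nu I01 ->
  fine (Q [set w | N w = n]) = nu I01 ^+ n / n`!%:R * expR (- nu I01).
Proof.
move=> nu0; rewrite -poisson_process_count1//; last exact: measurable_itv.
by case: ppQ => pp _ _; congr (fine (Q _)); apply/seteqP; split => w /=;
  rewrite count_in_I01.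
Qed.

(** The counts in A, B and the rest of [0, 1] are independent Poisson variables; the product of
    their weights is the Poisson weight of the total times a multinomial weight. The joint form
    avoids dividing by the probability of [N = n], which vanishes when [m = 0 < n]. *)
Lemma poisson_process_trinomial (A B : set R) (m p : R) (n : nat)
    (G : nat -> nat -> bool) :
  measurable A -> measurable B -> A `<=` I01 -> B `<=` I01 -> A `&` B = set0 ->
  0 <= m -> 0 <= p <= 1 -> nu A = m * (p / 2) -> nu B = m * (p / 2) ->
  nu (I01 `\` (A `|` B)) = m * (1 - p) ->
  fine (Q [set w | G (count_in N X A w) (count_in N X B w) /\ N w = n]) =
  m ^+ n / n`!%:R * expR (- m) * trinomial n p G.
Proof.
move=> mA mB AI BI AB0 m0 /andP[p0 p1] nuA nuB nuC.
set C := _ `\` _ in nuC.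
have mC : measurable C.
  by apply: measurableD; [exact: measurable_itv|exact: measurableU].
have CI : C `<=` I01 by move=> x [].
have [pp _ ind] := ppQ.
pose cA := count_in N X A; pose cB := count_in N X B; pose cC := count_in N X C.
have mcA : measurable_nat cA by exact: measurable_count.
have mcB : measurable_nat cB by exact: measurable_count.
have mN := measurable_N pp.
have sumN w : N w = (cA w + cB w + cC w)%N.
  rewrite -(count_in_I01 pp w) -!count_inU//; last first.
    by rewrite /C setDE setIC -setIA [_ `&` (_ `|` _)]setIC setICr setI0.
  congr (count_in N X _ w); rewrite /C; apply/seteqP; split => x.
    by move=> Ix; have [|nAB] := pselect ((A `|` B) x); [left|right].
  by case=> [[]|[]]//; [exact: AI|exact: BI].
rewrite -/cA -/cB; set E := [set w | _].
have mE : measurable E.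
  apply: (measurableI (fun w => G (cA w) (cB w)) (fun w => N w = n)).
    exact: (measurable_nat_pair (fun a b => G a b)).
  exact: mN.
rewrite (fine_measure_partition (m := n.+1) Q (measurable_nat_op addn mcA mcB))//.
  rewrite mulr_sumr; apply: eq_bigr => i _.
  rewrite (fine_measure_partition (m := i.+1) Q mcA); first last.
  - by move=> w [_ /= <-]; rewrite ltnS leq_addr.
  - apply: measurableI => //; exact: (measurable_nat_op addn mcA mcB).
  rewrite mulr_sumr; apply: eq_bigr => a _.
  have [ai iN] := (leq_ord a, leq_ord i).
  case: (boolP (G a (i - a)%N)) => [Gab|Gab]; last first.
    rewrite !mulr0 -[X in Q X](_ : set0 = _) ?measure0//.
    apply/esym; rewrite -subset0 => w [[[/= Gw _] abi] wa].
    by move: Gab; rewrite -{2}abi -wa addKn Gw.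
  pose D (i : 'I_3) := nth set0 [:: A; B; C] i.
  pose K (j : 'I_3) : set nat := [set nth 0%N [:: val a; (i - a)%N; (n - i)%N] j].
  have mD j : measurable (D j) /\ D j `<=` I01.
    by case: j => -[|[|[|//]]] ?; rewrite /D/=.
  have tD : trivIset setT D.
    move=> j j' _ _; case: j => -[|[|[|//]]] ?; case: j' => -[|[|[|//]]] ?;
      rewrite /D/= => -[x [x1 x2]]; apply/val_inj => //=; exfalso.
    + by have : (A `&` B) x by []; rewrite AB0.
    + by case: x2 => _; apply; left.
    + by have : (A `&` B) x by []; rewrite AB0.
    + by case: x2 => _; apply; right.
    + by case: x1 => _; apply; left.
    + by case: x1 => _; apply; right.
  (* Since [G a (i - a)] holds, the event prescribes exactly the three counts [a], [i - a] and
     [n - i], and independence over disjoint sets applies. *)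
  have QZ : fine (Q (E `&` [set w | (cA w + cB w)%N = i] `&`
      [set w | cA w = a])) = \prod_(j < 3) fine (Q [set w |
        K j (count_in N X (D j) w)]).
    rewrite -(ind 3%N D mD tD K).
    congr (fine (Q _)); apply/seteqP; split => w /=.
      move=> [[[Gw wn] wi] wa] -[[|[|[|//]]] ?]; rewrite /K /D/= -/cA -/cB -/cC//.
        by apply/(@addnI (cA w)); rewrite wi wa subnKC.
      by apply/(@addnI i); rewrite -[in LHS]wi -sumN wn subnKC.
    move=> H.
    have := H (@Ordinal 3 0 isT); have := H (@Ordinal 3 1 isT).
    have := H (@Ordinal 3 2 isT); rewrite /K /D/= -/cA -/cB -/cC => wC wB wA.
    by rewrite /E/= sumN wA wB wC Gab subnKC// subnKC.
  rewrite QZ !big_ord_recr big_ord0/= mul1r /D/= /K/=.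
  rewrite !poisson_process_count1 ?nuA ?nuB ?nuC ?mulr_ge0 ?subr_ge0 ?divr_ge0//.
  rewrite mulr1 natrM.
  have nf : n`!%:R = ('C(n, i) * i`! * (n - i)`!)%:R :> R.
    by rewrite -mulnA bin_fact.
  have fi : i`!%:R = ('C(i, a) * a`! * (i - a)`!)%:R :> R.
    by rewrite -mulnA bin_fact.
  have em : expR (- m) =
      expR (- (m * (p / 2))) * expR (- (m * (p / 2))) * expR (- (m * (1 - p))).
    by rewrite -!expRD; congr expR; field.
  have pe : (p / 2) ^+ i = (p / 2) ^+ a * (p / 2) ^+ (i - a).
    by rewrite -exprD subnKC.
  have me : m ^+ n = m ^+ a * m ^+ (i - a) * m ^+ (n - i).
    by rewrite -!exprD subnKC// subnKC.
  rewrite nf natrM natrM fi !natrM em pe me !(exprMn _ m).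
  have nz k : k`!%:R != 0 :> R by rewrite pnatr_eq0 -lt0n fact_gt0.
  have bz k l : (l <= k)%N -> 'C(k, l)%:R != 0 :> R.
    by move=> lk; rewrite pnatr_eq0 -lt0n bin_gt0.
  have := (bz n i iN, bz i a ai).
  move: (nz a) (nz (i - a)%N) (nz (n - i)%N).
  move: (expR _) (expR (- (m * (1 - p)))) => e1 e2.
  move: (p / 2) (1 - p) => q1 q2.
  move=> ? ? ? [? ?]; field.
  by do !(apply/andP; split).
by move=> w [_ /= <-]; rewrite ltnS sumN leq_addr.
Qed.

End NullLaw.

(** * Dyadic cells and Haar functions *)

Section Dyadic.
Context {R : realType}.
Implicit Types (j k : nat) (x : R) (s : R -> R).

(** Half-open like the pieces of [psi], so that the two halves of a cell are exactly cells of the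
    next level; the point 1 lies in no cell with [k < 2 ^ j]. *)
Definition dyadic j k : set R := `[k%:R / 2 ^+ j, k.+1%:R / 2 ^+ j[.

Lemma dyadicP j k x : dyadic j k x <-> k%:R <= 2 ^+ j * x < k.+1%:R.
Proof.
by rewrite /dyadic/= in_itv/= ler_pdivrMr ?exprn_gt0// ltr_pdivlMr ?exprn_gt0//
  mulrC.
Qed.

Lemma measurable_dyadic j k : measurable (dyadic j k).
Proof. exact: measurable_itv. Qed.

Lemma dyadic_inj j k k' x : dyadic j k x -> dyadic j k' x -> k = k'.
Proof.
move=> /dyadicP/andP[kx xk] /dyadicP/andP[k'x xk'].
have := le_lt_trans kx xk'; have := le_lt_trans k'x xk.
by rewrite !ltr_nat !ltnS => kk' k'k; apply/eqP; rewrite eqn_leq kk' k'k.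
Qed.

Lemma natr_double (k : nat) : (k.*2%:R = 2 * k%:R :> R) *
  (k.*2.+1%:R = 2 * k%:R + 1 :> R) * (k.*2.+2%:R = 2 * k%:R + 2 :> R) *
  (k.+1%:R = k%:R + 1 :> R).
Proof.
have E : k.*2%:R = 2 * k%:R :> R by rewrite -muln2 natrM mulrC.
have S (m : nat) : m.+1%:R = m%:R + 1 :> R by rewrite natr1.
by rewrite !(S k.*2.+1, S k.*2, S k) E -addrA.
Qed.

Lemma dyadic_split j k :
  dyadic j k = dyadic j.+1 k.*2 `|` dyadic j.+1 k.*2.+1.
Proof.
apply/seteqP; split => x.
  move=> /dyadicP/andP[]; rewrite (natr_double k) => kx xk.
  have [xl|xl] := ltP (2 ^+ j.+1 * x) (k.*2.+1)%:R; [left|right];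
    apply/dyadicP/andP; move: xl; rewrite !(natr_double k) exprS -mulrA; split; lra.
by case=> /dyadicP/andP[]; rewrite !(natr_double k) exprS -mulrA => kx xk;
  apply/dyadicP/andP; rewrite ?(natr_double k); split; lra.
Qed.

Lemma dyadic_half_disjoint j k : dyadic j.+1 k.*2 `&` dyadic j.+1 k.*2.+1 = set0.
Proof.
rewrite -subset0 => x [x1 x2]; have /eqP := dyadic_inj x1 x2.
by rewrite -[X in X == _]addn0 -addn1 eqn_add2l.
Qed.

Lemma dyadic_sub j k : (k < 2 ^ j)%N -> dyadic j k `<=` I01.
Proof.
move=> kj x /dyadicP/andP[kx xk]; rewrite /I01/= in_itv/=.
have p0 : 0 < 2 ^+ j :> R by rewrite exprn_gt0.
rewrite -(pmulr_rge0 _ p0) (le_trans _ kx)//=.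
rewrite -(ler_pM2l p0) mulr1 (le_trans (ltW xk))//.
by rewrite -natrX ler_nat.
Qed.

Lemma ltn_half_dyadic j k : (k < 2 ^ j)%N ->
  (k.*2 < 2 ^ j.+1)%N /\ (k.*2.+1 < 2 ^ j.+1)%N.
Proof.
move=> kj; rewrite expnS mul2n ltn_double; split => //.
by rewrite -doubleS leq_double.
Qed.

Lemma dyadic_half_sub j k : (k < 2 ^ j)%N ->
  dyadic j.+1 k.*2 `<=` I01 /\ dyadic j.+1 k.*2.+1 `<=` I01.
Proof. by move=> /ltn_half_dyadic[? ?]; split; exact: dyadic_sub. Qed.

Lemma lebesgue_measure_dyadic j k :
  lebesgue_measure (dyadic j k) = (2 ^- j : R)%:E.
Proof.
rewrite lebesgue_measure_itv/= lte_fin ltr_pM2r ?invr_gt0 ?exprn_gt0//.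
by rewrite ltr_nat leqnn -EFinB -mulrBl -natrB// subSnn mul1r.
Qed.

Lemma haarE j k x : haar (j, k) x = 2 `^ (j%:R / 2) *
  (\1_(dyadic j.+1 k.*2) x - \1_(dyadic j.+1 k.*2.+1) x).
Proof.
have l : (2 ^+ j * x - k%:R \in `[0, 2^-1[%classic) =
    (x \in dyadic j.+1 k.*2).
  apply/idP/idP; rewrite !inE/= in_itv/=.
    move=> /andP[h1 h2]; apply/dyadicP; rewrite !(natr_double k) exprS -mulrA.
    by apply/andP; split; lra.
  move=> /dyadicP; rewrite !(natr_double k) exprS -mulrA => /andP[h1 h2].
  by apply/andP; split; lra.
have r : (2 ^+ j * x - k%:R \in `[2^-1, 1[%classic) =
    (x \in dyadic j.+1 k.*2.+1).
  apply/idP/idP; rewrite !inE/= in_itv/=.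
    move=> /andP[h1 h2]; apply/dyadicP; rewrite !(natr_double k) exprS -mulrA.
    by apply/andP; split; lra.
  move=> /dyadicP; rewrite !(natr_double k) exprS -mulrA => /andP[h1 h2].
  by apply/andP; split; lra.
by rewrite /haar /psi !indicE/= l r.
Qed.

Lemma sqr_pow2_half j : (2 `^ (j%:R / 2)) ^+ 2 = 2 ^+ j :> R.
Proof.
by rewrite -powR_mulrn ?powR_ge0// -powRrM divfK// powR_mulrn.
Qed.

End Dyadic.

(** * The statistic as a function of two cell counts *)

Section Statistic.
Context {R : realType} {d : measure_display} {Omega : measurableType d}.
Variables (L : R) (N : Omega -> nat) (X : nat -> Omega -> R).

Definition counts_stat (j a b : nat) : R :=
  2 ^+ j / L ^+ 2 * ((a%:R - b%:R) ^+ 2 - (a + b)%:R).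

(** The sum over pairs of distinct points is the square of the sum minus the sum of squares, and the
    Haar function is plus or minus 2^(j/2) on the two halves of its cell. *)
Lemma TstatE j k w : Tstat L N X (j, k) w =
  counts_stat j (count_in N X (dyadic j.+1 k.*2) w)
                (count_in N X (dyadic j.+1 k.*2.+1) w).
Proof.
set A := dyadic _ _; set B := dyadic _ _; pose h := 2 `^ (j%:R / 2) : R.
pose f (l : 'I_(N w)) := haar (j, k) (X l w).
have fE l : f l = h * ((X l w \in A)%:R - (X l w \in B)%:R) by rewrite /f haarE !indicE.
have -> : Tstat L N X (j, k) w =
    (L ^+ 2)^-1 * ((\sum_l f l) ^+ 2 - \sum_l f l ^+ 2).
  rewrite /Tstat; congr (_ * _).
  rewrite expr2 mulr_suml -sumrB; apply: eq_bigr => l _.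
  by rewrite mulr_sumr [X in _ = X - _](bigD1 l)//= -expr2 addrAC subrr add0r.
rewrite (eq_bigr _ (fun l _ => fE l)) -mulr_sumr sumrB.
have cE (Y : set R) : \sum_(l < N w) (X l w \in Y)%:R = (count_in N X Y w)%:R :> R.
  by rewrite natr_sum.
rewrite !cE.
have -> : \sum_l f l ^+ 2 =
    2 ^+ j * (count_in N X A w + count_in N X B w)%:R.
  rewrite -count_inU; last exact: dyadic_half_disjoint.
  rewrite natr_sum mulr_sumr; apply: eq_bigr => l _.
  rewrite fE exprMn sqr_pow2_half in_setU; congr (_ * _).
  have [xA|_] := boolP (_ \in A); have [xB|_] := boolP (_ \in B);
    rewrite ?subr0 ?subrr ?sub0r ?sqrrN ?expr1n ?expr0n//=.
  suff : (A `&` B) (X l w) by rewrite dyadic_half_disjoint.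
  by split; exact: set_mem.
rewrite exprMn sqr_pow2_half -mulrBr /counts_stat natrD.
by rewrite mulrA [_^-1 * _]mulrC.
Qed.

End Statistic.

(** * Parseval's identity for bounded functions *)

Section Parseval.
Context {R : realType}.
Local Notation mu := (@lebesgue_measure R).
Variables (s : R -> R) (M : R).
Hypothesis ms : measurable_fun I01 s.
Hypothesis sM : forall x, I01 x -> `|s x| <= M.

Lemma measurable_I01 : measurable (I01 : set R).
Proof. exact: measurable_itv. Qed.

Lemma lebesgue_measure_I01 : mu I01 = 1%E.
Proof. by rewrite lebesgue_measure_itv/= lte_fin ltr01 -EFinB subr0. Qed.

Lemma integrable_bounded (f : R -> R) (B : R) :
  measurable_fun I01 f -> (forall x, I01 x -> `|f x| <= B) ->
  mu.-integrable I01 (EFin \o f).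
Proof.
move=> mf fB; apply: measurable_bounded_integrable => //.
- exact: measurable_I01.
- by rewrite [ltLHS](_ : _ = 1%E) ?ltry//; exact: lebesgue_measure_I01.
- exists B; split; first exact: num_real.
  by move=> y By x Ix /=; rewrite (le_trans (fB x Ix))// ltW.
Qed.

Lemma integrable_sub A : measurable A -> A `<=` I01 ->
  mu.-integrable A (EFin \o s).
Proof.
move=> mA AI; apply: (@integrableS _ _ _ mu I01) => //; first exact: measurable_I01.
exact: integrable_bounded sM.
Qed.

Lemma integrable_sqr : mu.-integrable I01 (EFin \o (fun x => s x ^+ 2)).
Proof.
apply: (@integrable_bounded _ (M ^+ 2)).
  exact: measurable_funX.
move=> x Ix; rewrite normrX lerXn2r ?nnegrE// ?sM//.
by rewrite (le_trans _ (sM Ix)).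
Qed.

Definition cell (j k : nat) : R := \int[mu]_(x in dyadic j k) s x.

(** The squared norm of the projection of [s] onto the functions constant on the cells of level [j],
    whose value on a cell is [2 ^+ j * cell j k]. *)
Definition energy (j : nat) : R := \sum_(k < 2 ^ j) 2 ^+ j * cell j k ^+ 2.

Lemma cell_split j k : (k < 2 ^ j)%N ->
  cell j k = cell j.+1 k.*2 + cell j.+1 k.*2.+1.
Proof.
move=> kj; rewrite /cell dyadic_split Rintegral_setU//.
- exact: measurable_dyadic.
- exact: measurable_dyadic.
- rewrite -dyadic_split; apply: integrable_sub; first exact: measurable_dyadic.
  exact: dyadic_sub.
- by rewrite disj_set2E dyadic_half_disjoint.
Qed.

Lemma normr_cell_le j k : (k < 2 ^ j)%N -> `|cell j k| <= M / 2 ^+ j.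
Proof.
move=> kj; have is_ := integrable_sub (measurable_dyadic j k) (dyadic_sub kj).
apply: le_trans (le_normr_Rintegral _ is_) _; first exact: measurable_dyadic.
have -> : M / 2 ^+ j = \int[mu]_(x in dyadic j k) M.
  rewrite Rintegral_cst ?[X in fine X](_ : _ = (2 ^- j)%:E)//.
    exact: lebesgue_measure_dyadic.
  exact: measurable_dyadic.
apply: le_Rintegral.
- exact: measurable_dyadic.
- exact: integrable_norm.
- apply: (@integrableS _ _ _ mu I01).
  + exact: measurable_I01.
  + exact: measurable_dyadic.
  + exact: dyadic_sub.
  + by apply: (@integrable_bounded _ `|M|) => //; exact: measurable_cst.
- by move=> x xD; apply: sM; exact: dyadic_sub xD.
Qed.

Lemma coef_cell j k : (k < 2 ^ j)%N ->
  coef s (j, k) = 2 `^ (j%:R / 2) * (cell j.+1 k.*2 - cell j.+1 k.*2.+1).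
Proof.
move=> kj; have [lI rI] := dyadic_half_sub (R := R) kj.
have [ml mr] := (measurable_dyadic (R := R) j.+1 k.*2,
                 measurable_dyadic (R := R) j.+1 k.*2.+1).
have sE (A : set R) : measurable A -> A `<=` I01 ->
    mu.-integrable I01 (EFin \o (fun x => s x * \1_A x)) /\
    \int[mu]_(x in I01) (s x * \1_A x) = \int[mu]_(x in A) s x.
  move=> mA AI; have E : (fun x => s x * \1_A x) = s \_ A.
    apply/funext => x; rewrite patchE indicE.
    by case: ifP => _; rewrite ?mulr1 ?mulr0.
  split.
    apply: (@integrable_bounded _ M).
      exact: (measurable_funM ms (measurable_indic mA)).
    move=> x Ix; rewrite indicE; case: (_ \in _); rewrite ?mulr1 ?sM//.
    by rewrite mulr0 normr0 (le_trans _ (sM Ix)).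
  by rewrite E -Rintegral_mkcondr ((setIidPr _ _).2 AI).
have [il El] := sE _ ml lI; have [ir Er] := sE _ mr rI.
rewrite /coef /inner /cell -El -Er -RintegralB//; last exact: measurable_I01.
rewrite -RintegralZl//; last first.
- exact: (@integrableB _ _ _ mu I01 measurable_I01 _ _ il ir).
- exact: measurable_I01.
by apply: eq_Rintegral => x _; rewrite haarE; ring.
Qed.

Lemma sum_double (V : nmodType) (F : nat -> V) n :
  \sum_(k < n.*2) F k = \sum_(k < n) (F k.*2 + F k.*2.+1).
Proof.
elim: n => [|n IH]; first by rewrite !big_ord0.
by rewrite doubleS !big_ord_recr/= IH addrA.
Qed.

(** On each cell this is the parallelogram identity 2 (x^2 + y^2) = (x + y)^2 + (x - y)^2 for the
    integrals x, y over its halves. *)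
Lemma energyS j : energy j.+1 = energy j + \sum_(k < 2 ^ j) coef s (j, val k) ^+ 2.
Proof.
rewrite /energy expnS mul2n.
rewrite (sum_double (fun k => 2 ^+ j.+1 * cell j.+1 k ^+ 2)) -big_split/=.
apply: eq_bigr => k _; rewrite (cell_split (ltn_ord k)) coef_cell// exprMn sqr_pow2_half exprS.
ring.
Qed.

Lemma energyE J : energy J = (\int[mu]_(x in I01) s x) ^+ 2 +
  \sum_(0 <= j < J) \sum_(k < 2 ^ j) coef s (j, val k) ^+ 2.
Proof.
elim: J => [|J IH]; last by rewrite energyS IH big_nat_recr//= addrA.
rewrite big_geq// addr0 /energy expn0 big_ord1 expr0 mul1r; congr (_ ^+ 2).
(* The single cell of level 0 is [0, 1[, which differs from [I01] by a null set. *)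
rewrite /cell /dyadic /I01 expr0 !divr1 Rintegral_itv_bndo_bndc//.
rewrite -[X in _.-integrable X](_ : dyadic 0 0 = _).
  by apply: integrable_sub; [exact: measurable_dyadic|exact: dyadic_sub].
by rewrite /dyadic expr0 !divr1.
Qed.

Let g := s \_ I01.

(* The balls are an arbitrary choice: the differentiation theorem asks for a
   family of sets at every real x, but only the points of [0, 1[ matter. *)
Let E (x : R) (n : nat) : set R :=
  if (0 <= x < 1) then dyadic n (Num.truncn (2 ^+ n * x)) else ball x (2 ^- n).

Lemma dyadic_truncn n (x : R) : 0 <= x < 1 ->
  dyadic n (Num.truncn (2 ^+ n * x)) x /\ (Num.truncn (2 ^+ n * x) < 2 ^ n)%N.
Proof.
move=> /andP[x0 x1].
have p0 : 0 < 2 ^+ n :> R by rewrite exprn_gt0.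
have /truncn_itv h : 0 <= 2 ^+ n * x by rewrite mulr_ge0// ltW.
split; first exact/dyadicP.
rewrite -(ltr_nat R) (le_lt_trans (proj1 (andP h)))//.
by rewrite natrX -[ltRHS]mulr1 ltr_pM2l.
Qed.

Let nicely x : nicely_shrinking x (E x).
Proof.
have p0 n : 0 < 2 ^- n :> R by rewrite invr_gt0 exprn_gt0.
split.
  by move=> n; rewrite /E; case: ifP => _; [exact: measurable_dyadic|exact: measurable_ball].
(* A cell of level n containing x lies in the ball of radius 2^-n around x, whose measure is twice
   that of the cell: hence the constant 2. *)
exists (2, fun n => PosNum (p0 n)); split => //=.
- have -> : (fun n => 2 ^- n) = (fun n => 2^-1 ^+ n) :> (R^nat).
    by apply/funext => n; rewrite exprVn.
  by apply: cvg_expr; rewrite ger0_norm// invf_lt1// ltr1n.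
- move=> n; rewrite /E; case: ifP => [x01 y|_ y //].
  have [/dyadicP xk _] := dyadic_truncn n x01.
  move=> /dyadicP; move: xk; set k := Num.truncn _; rewrite -natr1.
  move=> /andP[h1 h2] /andP[h3 h4]; rewrite /ball/= -(ltr_pM2l (x := 2 ^+ n)) ?exprn_gt0//.
  rewrite divff ?gt_eqF ?exprn_gt0// -[X in X * _]gtr0_norm ?exprn_gt0//.
  by rewrite -normrM mulrBr ltr_norml; apply/andP; split; lra.
- move=> n; rewrite (lebesgue_measure_ball _ (ltW (p0 n))) /E; case: ifP => _.
    by rewrite lebesgue_measure_dyadic -EFinM lee_fin mulr2n mulrDl mul1r.
  rewrite (lebesgue_measure_ball _ (ltW (p0 n))) -EFinM lee_fin mulr2n.
  by have := p0 n; lra.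
Qed.

(** [energy n] is the integral of [H n], the squared step function of the dyadic averages of [s].
    These averages tend to [s] almost everywhere by Lebesgue differentiation, and [H n] is bounded
    by [M ^+ 2], so dominated convergence applies. *)
Lemma energy_cvg : energy n @[n --> \oo] --> \int[mu]_(x in I01) (s x ^+ 2).
Proof.
pose H (n : nat) (x : R) : R := \sum_(k < 2 ^ n) (2 ^+ n * cell n k) ^+ 2 * \1_(dyadic n k) x.
have HE (n : nat) (x : R) : 0 <= x < 1 ->
    H n x = (2 ^+ n * cell n (Num.truncn (2 ^+ n * x))) ^+ 2.
  move=> x01; have [xk kn] := dyadic_truncn n x01; set k := Num.truncn _ in xk kn *.
  rewrite /H (bigD1 (Ordinal kn))//= indicE mem_set// mulr1 big1 ?addr0//.
  move=> i /negP ik; rewrite indicE memNset ?mulr0// => xi.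
  by apply: ik; apply/eqP/val_inj/(dyadic_inj xi xk).
have Hint n : (\int[mu]_(x in I01) (H n x)%:E)%E = (energy n)%:E.
  under eq_integral do rewrite /H -sumEFin.
  rewrite integral_sum//; last 2 first.
  - exact: measurable_I01.
  - move=> k; apply: (@integrable_bounded _ ((2 ^+ n * cell n k) ^+ 2)).
      apply: measurable_funM; first exact: measurable_cst.
      by apply: measurable_indic; exact: measurable_dyadic.
    move=> x _; rewrite indicE; case: (_ \in _); rewrite ?mulr1 ?mulr0 ?normr0 ?sqr_ge0//.
    by rewrite ger0_norm ?sqr_ge0.
  rewrite /energy -sumEFin; apply: eq_bigr => k _.
  under eq_integral do rewrite EFinM.
  rewrite ge0_integralZl//; last first.
  - by rewrite lee_fin sqr_ge0.
  - by apply/measurable_EFinP; apply: measurable_indic; exact: measurable_dyadic.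
  - exact: measurable_I01.
  rewrite integral_indic; [|exact: measurable_I01|exact: measurable_dyadic].
  rewrite ((setIidPl _ _).2 (dyadic_sub (ltn_ord k))).
  rewrite [X in (_ * X)%E]lebesgue_measure_dyadic -EFinM; congr EFin.
  have : 2 ^+ n != 0 :> R by rewrite expf_neq0.
  by move=> nz; field.
have lg : locally_integrable setT g.
  apply: integrable_locally; first exact: measurable_I01.
  exact: integrable_bounded sM.
(* No cell contains the point 1, so [H n] vanishes there; it is discarded as a null set. *)
have ne1 : \forall x \ae mu, x != 1.
  exists [set 1]; split => //; first exact: lebesgue_measure_set1.
  by move=> x /= /negP; rewrite negbK => /eqP.
have aeF : Filter (nbhs (almost_everywhere mu)) by exact: ae_filter_ringOfSetsType.
have x01 (x : R) : x != 1 -> I01 x -> 0 <= x < 1.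
  by move=> x1; rewrite /I01/= in_itv/= lt_neqAle x1.
have HM n (x : R) : 0 <= x < 1 -> (`|(H n x)%:E| <= (M ^+ 2)%:E)%E.
  move=> /[dup] x1 /HE ->; have [_ kn] := dyadic_truncn n x1.
  rewrite lee_fin normrX lerXn2r ?nnegrE//.
    apply: le_trans (normr_ge0 (s x)) (sM _).
    by rewrite /I01/= in_itv/=; case/andP: x1 => -> /ltW.
  rewrite normrM gtr0_norm ?exprn_gt0// mulrC -ler_pdivlMr ?exprn_gt0//.
  exact: normr_cell_le.
have ae_cvg : \forall x \ae mu, I01 x -> (H n x)%:E @[n --> \oo] --> (s x ^+ 2)%:E.
  apply: filterS2 ne1 (lebesgue_differentiation lg) => x x1 lx Ix.
  have x0 := x01 x x1 Ix.
  apply/fine_cvgP; split; first exact: nearW.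
  rewrite (_ : fine \o _ = (fun n => 2 ^+ n * cell n (Num.truncn (2 ^+ n * x))) \*
      (fun n => 2 ^+ n * cell n (Num.truncn (2 ^+ n * x)))); last first.
    by apply/funext => n /=; rewrite HE// expr2.
  suff h : 2 ^+ n * cell n (Num.truncn (2 ^+ n * x)) @[n --> \oo] --> s x.
    by rewrite expr2; exact: cvgM.
  have := nice_lebesgue_differentiation nicely lg lx.
  rewrite /g patchE mem_set// => /fine_cvg; apply: cvg_trans.
  apply: near_eq_cvg; apply: nearW => n /=; rewrite /E x0.
  have [_ kn] := dyadic_truncn n x0; set k := Num.truncn _ in kn *.
  rewrite lebesgue_measure_dyadic inver invr_eq0 expf_eq0 pnatr_eq0 andbF invrK.
  rewrite (_ : (\int[_]_(y in _) _)%E = (cell n k)%:E)//.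
  rewrite /cell /Rintegral fineK; last first.
    apply: integrable_fin_num; first exact: measurable_dyadic.
    by apply: integrable_sub; [exact: measurable_dyadic|exact: dyadic_sub].
  apply: eq_integral => y /set_mem /(dyadic_sub kn) Iy.
  by rewrite patchE mem_set.
have [] := @dominated_convergence _ _ _ mu I01 measurable_I01 (fun n x => (H n x)%:E)
  (fun x => (s x ^+ 2)%:E) (cst (M ^+ 2)%:E).
- move=> n; apply/measurable_EFinP; apply: measurable_sum => k.
  apply: measurable_funM; first exact: measurable_cst.
  by apply: measurable_indic; exact: measurable_dyadic.
- by apply/measurable_EFinP; exact: measurable_funX.
- exact: ae_cvg.
- by apply: (@integrable_bounded (cst (M ^+ 2)) `|M ^+ 2|) => //;
    exact: measurable_cst.
- by apply: filterS ne1 => x x1 n Ix; apply: HM; exact: x01.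
move=> is2 _ cv.
have fin : (\int[mu]_(x in I01) (s x ^+ 2)%:E)%E \is a fin_num.
  by apply: integrable_fin_num; first exact: measurable_I01.
rewrite -(fineK fin) in cv; move/fine_cvg : cv; apply: cvg_trans.
by apply: near_eq_cvg; apply: nearW => n /=; rewrite Hint.
Qed.

End Parseval.

(** * Distance to the constants *)

Section Distance.
Context {R : realType}.
Local Notation mu := (@lebesgue_measure R).

Lemma Rintegral_cst_I01 (c : R) : \int[mu]_(x in I01) c = c.
Proof.
rewrite Rintegral_cst ?[X in fine X](_ : _ = 1%E) ?mulr1//.
  exact: lebesgue_measure_I01.
exact: measurable_I01.
Qed.

(** The infimum is tested at the constant equal to the mean of [s], where the squared distance is
    the variance. *)
Lemma dist2_S0_le (s : R -> R) (M : R) :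
  measurable_fun I01 s -> (forall x, I01 x -> `|s x| <= M) ->
  dist2_set s S0 ^+ 2 <=
  \int[mu]_(x in I01) (s x ^+ 2) - (\int[mu]_(x in I01) s x) ^+ 2.
Proof.
move=> ms sM; set c := \int[mu]_(x in I01) s x.
have isq := integrable_sqr ms sM; have is1 := integrable_bounded ms sM.
have -> : \int[mu]_(x in I01) (s x ^+ 2) - c ^+ 2 = dist2 s (cst c) ^+ 2.
  rewrite /dist2 /norm2 /inner sqr_sqrtr; last first.
    by apply: Rintegral_ge0 => x _; rewrite -expr2 sqr_ge0.
  have il : mu.-integrable I01 (EFin \o (fun x => 2 * c * s x)).
    apply: (@integrable_bounded _ _ (`|2 * c| * M)).
      by apply: measurable_funM => //; exact: measurable_cst.
    by move=> x Ix; rewrite normrM ler_wpM2l// sM.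
  have ic : mu.-integrable I01 (EFin \o cst (c ^+ 2)).
    by apply: (@integrable_bounded _ _ `|c ^+ 2|) => //; exact: measurable_cst.
  have ib : mu.-integrable I01 (EFin \o (fun x => s x ^+ 2 - 2 * c * s x)).
    exact: (@integrableB _ _ _ mu I01 measurable_I01 _ _ isq il).
  have sq x : (s x - c) * (s x - c) = s x ^+ 2 - 2 * c * s x + c ^+ 2 by ring.
  under [RHS]eq_Rintegral do rewrite sq.
  rewrite RintegralD//; last exact: measurable_I01.
  rewrite RintegralB//; last exact: measurable_I01.
  rewrite RintegralZl//; last exact: measurable_I01.
  by rewrite Rintegral_cst_I01 -/c; ring.
have lb : lbound [set dist2 s t | t in S0] 0.
  by move=> _ [t _ <-]; exact: sqrtr_ge0.
have cS : [set dist2 s t | t in S0] (dist2 s (cst c)).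
  by exists (cst c) => //; exists c.
rewrite lerXn2r ?nnegrE ?sqrtr_ge0//.
  by apply: lb_le_inf => //; exists (dist2 s (cst c)).
by apply: ge_inf => //; exists 0.
Qed.

(** By [energyE] and [energy_cvg] the variance is the limit of these partial sums. Sums of length
    [J + m] determine it, and can be split at level [J]. *)
Lemma dist2_S0_le_coef (s : R -> R) (M B : R) (J : nat) :
  measurable_fun I01 s -> (forall x, I01 x -> `|s x| <= M) ->
  (forall m, \sum_(0 <= j < J + m) \sum_(k < 2 ^ j) coef s (j, val k) ^+ 2 <= B) ->
  dist2_set s S0 ^+ 2 <= B.
Proof.
move=> ms sM sumB; apply: le_trans (dist2_S0_le ms sM) _.
rewrite lerBlDl; have cv := energy_cvg ms sM.
rewrite -(cvg_lim _ cv)//; apply: limr_le; first by apply/cvg_ex; eexists; exact: cv.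
exists J => // n /= Jn; rewrite (energyE ms sM) lerD2l.
by have := sumB (n - J)%N; rewrite subnKC.
Qed.

Lemma sum_geometric_le (q : R) (J m : nat) : 0 <= q < 1 ->
  \sum_(J <= j < J + m) q ^+ j <= q ^+ J / (1 - q).
Proof.
move=> /andP[q0 q1]; rewrite ler_pdivlMr ?subr_gt0//.
suff -> : (\sum_(J <= j < J + m) q ^+ j) * (1 - q) = q ^+ J - q ^+ (J + m).
  by rewrite lerBlDr lerDl exprn_ge0.
elim: m => [|m IH]; first by rewrite addn0 big_geq// mul0r subrr.
by rewrite addnS big_nat_recr ?leq_addr//= mulrDl IH exprS; ring.
Qed.

Lemma pow2N_lt1 (delta : R) : 0 < delta -> 2 `^ (- (2 * delta)) < 1 :> R.
Proof.
move=> d0; rewrite powRN invf_lt1 ?powR_gt0//.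
rewrite [ltLHS](_ : 1 = 1 `^ (2 * delta)); last by rewrite powR1.
by rewrite gt0_ltr_powR ?nnegrE ?mulr_gt0// ltr1n.
Qed.

Lemma dist2_S0_thresholded (s : R -> R) (M delta gamma Rad Rad' t : R) (J : nat) :
  0 < delta -> 0 < t ->
  (besov delta Rad `&` weak_besov gamma Rad' `&` bounded_by M) s ->
  (forall j k, (j < J)%N -> (k < 2 ^ j)%N -> coef s (j, k) ^+ 2 <= t) ->
  dist2_set s S0 ^+ 2 <= Rad' ^+ 2 * t `^ (2 * gamma / (1 + 2 * gamma)) +
    Rad ^+ 2 * ((2 `^ (- (2 * delta))) ^+ J / (1 - 2 `^ (- (2 * delta)))).
Proof.
move=> d0 t0 [[[[[ms _] _] sB] [_ sW]] sM] ct.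
apply: (dist2_S0_le_coef (J := J) ms sM) => m.
rewrite (big_cat_nat _ (n := J)) ?leq_addr//=; apply: lerD.
  (* Every coefficient below level [J] is under the threshold, so the indicator in the weak Besov
     series is 1 there and the partial sum is dominated by that series. *)
  rewrite -lee_fin -sumEFin; apply: le_trans (sW t t0).
  apply: le_trans (nneseries_lim_ge J _) => /=; last first.
    move=> j _ _; rewrite lee_fin; apply: sumr_ge0 => k _.
    by rewrite mulr_ge0 ?sqr_ge0.
  rewrite !sumEFin lee_fin big_nat_cond [leRHS]big_nat_cond.
  apply: ler_sum => j; rewrite andbT => jJ; apply: ler_sum => k _.
  by rewrite ct ?mulr1.
set q := 2 `^ _.
have q01 : 0 <= q < 1 by rewrite powR_ge0 pow2N_lt1.
apply: (@le_trans _ _ (\sum_(J <= j < J + m) Rad ^+ 2 * q ^+ j)).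
  apply: ler_sum => j _; apply: le_trans (sB j) _.
  rewrite ler_wpM2l ?sqr_ge0// /q -powR_mulrn ?powR_ge0// -powRrM.
  by rewrite (_ : - (2 * j%:R * delta) = - (2 * delta) * j%:R)//; ring.
by rewrite -mulr_sumr ler_wpM2l ?sqr_ge0// sum_geometric_le.
Qed.

End Distance.

(** * Critical values of the test *)

Lemma seq_gap (R : realDomainType) (q : R) (r : seq R) :
  exists2 y, q < y & forall x, x \in r -> q < x -> y <= x.
Proof.
elim: r => [|x r [y qy yr]]; first by exists (q + 1); rewrite ?ltrDl.
have [qx|xq] := ltP q x; last first.
  by exists y => // z; rewrite inE => /predU1P[->|/yr//]; rewrite ltNge xq.
exists (Num.min x y); first by rewrite lt_min qx.
move=> z; rewrite inE => /predU1P[-> _|zr qz]; first by rewrite ge_min lexx.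
by rewrite ge_min yr ?orbT.
Qed.

Lemma seq_ubound (R : realDomainType) (r : seq R) :
  exists y, forall x, x \in r -> x <= y.
Proof.
elim: r => [|x r [y yr]]; first by exists 0.
exists (Num.max x y) => z; rewrite inE => /predU1P[->|zr]; rewrite le_max ?lexx//.
by rewrite yr ?orbT.
Qed.

Section NullTest.
Context {R : realType} {d : measure_display} {Omega : measurableType d}.
Variables (L : R) (N : Omega -> nat) (X : nat -> Omega -> R).
Variables (P : (R -> R) -> probability Omega R).
Hypothesis L0 : 0 < L.
Hypothesis modelP : poisson_model L N X P.
Local Notation mu := (@lebesgue_measure R).
Implicit Types (s : R -> R) (j k n : nat) (u : R).

Lemma intensity_cst (c : R) : 0 <= c -> intensity (cst c).
Proof.
move=> c0; split; last by [].
split; first exact: measurable_cst.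
by apply: (@integrable_bounded _ (cst (c ^+ 2)) `|c ^+ 2|) => //; exact: measurable_cst.
Qed.

Lemma model_point_process : point_process N X.
Proof. by have [] := modelP (intensity_cst ler01). Qed.

Let countl j k := count_in N X (dyadic j.+1 k.*2).
Let countr j k := count_in N X (dyadic j.+1 k.*2.+1).

Lemma measurable_counts j k (G : nat -> nat -> Prop) :
  measurable [set w | G (countl j k w) (countr j k w)].
Proof.
have pp := model_point_process.
by apply: measurable_nat_pair; apply: measurable_count => //; exact: measurable_dyadic.
Qed.

Lemma null_intensity s : (S0 `&` intensity) s ->
  exists2 c, 0 <= c & forall x, I01 x -> s x = c.
Proof.
move=> [[c sc] [_ s0]]; exists c => //.
have I0 : I01 (0 : R) by rewrite /I01/= in_itv/= lexx ler01.
by rewrite -(sc 0 I0) s0.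
Qed.

Lemma Rintegral_null s (c : R) (A : set R) : measurable A -> A `<=` I01 ->
  (forall x, I01 x -> s x = c) -> \int[mu]_(x in A) s x = c * fine (mu A).
Proof.
move=> mA AI sc; rewrite -Rintegral_cst//.
by apply: eq_Rintegral => x /set_mem/AI; exact: sc.
Qed.

Lemma null_N s (c : R) n : intensity s -> 0 <= c -> (forall x, I01 x -> s x = c) ->
  fine (P s [set w | N w = n]) = (L * c) ^+ n / n`!%:R * expR (- (L * c)).
Proof.
move=> si c0 sc; have nu : L * \int[mu]_(x in I01) s x = L * c.
  rewrite (Rintegral_null _ _ sc)//; last exact: measurable_I01.
  by rewrite [mu _]lebesgue_measure_I01 mulr1.
by rewrite (poisson_process_N (modelP si)) ?nu// mulr_ge0// ltW.
Qed.

Let pow2_01 j : 0 <= (2 ^- j : R) <= 1.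
Proof. by rewrite invr_ge0 exprn_ge0//= invf_le1 ?exprn_gt0// exprn_ege1// ler1n. Qed.

(** The trinomial factor is free of [c]: this is the common conditional law under the null
    hypothesis. The product form covers [c = 0] as well. *)
Lemma null_trinomial s (c : R) j k n (G : nat -> nat -> bool) : (k < 2 ^ j)%N ->
  intensity s -> 0 <= c -> (forall x, I01 x -> s x = c) ->
  fine (P s [set w | G (countl j k w) (countr j k w) /\ N w = n]) =
  fine (P s [set w | N w = n]) * trinomial n (2 ^- j) G.
Proof.
move=> kj si c0 sc; rewrite (null_N n si c0 sc).
have [lI rI] := dyadic_half_sub (R := R) kj.
have half j' k' : (k' < 2 ^ j')%N ->
    L * \int[mu]_(x in dyadic j' k') s x = L * c * 2 ^- j'.
  move=> kj'; rewrite (Rintegral_null _ _ sc); last 2 first.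
  - exact: measurable_dyadic.
  - exact: dyadic_sub.
  by rewrite [mu _]lebesgue_measure_dyadic mulrA.
have [kl kr] := ltn_half_dyadic kj.
have p2 : 2 ^- j / 2 = 2 ^- j.+1 :> R by rewrite exprSr invfM.
apply: (poisson_process_trinomial (modelP si)) => //.
- exact: measurable_dyadic.
- exact: measurable_dyadic.
- exact: dyadic_half_disjoint.
- by rewrite mulr_ge0// ltW.
- by rewrite half// p2.
- by rewrite half// p2.
- rewrite -dyadic_split (Rintegral_null _ _ sc); last 2 first.
  + by apply: measurableD; [exact: measurable_I01|exact: measurable_dyadic].
  + by move=> x [].
  have -> : fine (mu (I01 `\` dyadic j k)) = 1 - 2 ^- j.
    rewrite measureD; last 3 first.
    + exact: measurable_I01.
    + exact: measurable_dyadic.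
    + by rewrite [ltLHS]lebesgue_measure_I01 ltry.
    rewrite ((setIidPr _ _).2 (dyadic_sub kj)).
    by rewrite [X in (X - _)%E]lebesgue_measure_I01
      [X in (_ - X)%E]lebesgue_measure_dyadic.
  by rewrite mulrA.
Qed.

Lemma null_cdfE j k n t : (k < 2 ^ j)%N ->
  null_cdf L N X P n (j, k) t =
  trinomial n (2 ^- j) (fun a b => counts_stat L j a b <= t).
Proof.
move=> kj; rewrite /null_cdf /cprob.
have -> : [set w | Tstat L N X (j, k) w <= t] `&` [set w | N w = n] =
    [set w | counts_stat L j (countl j k w) (countr j k w) <= t /\ N w = n].
  by apply/seteqP; split => w /=; rewrite TstatE.
have c1 : forall x : R, I01 x -> cst 1 x = 1 :> R by [].
rewrite (null_trinomial n (fun a b => counts_stat L j a b <= t) kj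
  (intensity_cst ler01) ler01 c1).
rewrite mulrC mulKf// (null_N n (intensity_cst ler01) ler01 c1) mulr1.
by rewrite gt_eqF// mulr_gt0 ?expR_gt0// divr_gt0 ?exprn_gt0// ltr0n fact_gt0.
Qed.

(** The threshold of [trinomial_tail] at [p = 2 ^- j], multiplied by the normalisation
    [2 ^+ j / L ^+ 2] of the statistic. *)
Definition quantile_bound j n u : R :=
  2 ^+ j / L ^+ 2 * (8 * ln (2 / u) * (n%:R * 2 ^- j + ln (2 / u))).

(** Dropping the negative term [- (a + b)] of [counts_stat] leaves the square controlled by
    [trinomial_tail]. *)
Lemma null_cdf_quantile_bound j k n u : (k < 2 ^ j)%N -> 0 < u < 2 ->
  1 - u <= null_cdf L N X P n (j, k) (quantile_bound j n u).
Proof.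
move=> kj u02; rewrite null_cdfE//.
suff : trinomial n (2 ^- j) (fun a b => ~~ (counts_stat L j a b <=
    quantile_bound j n u)) <= u by rewrite trinomialN; lra.
apply: le_trans (trinomial_tail n (pow2_01 j) u02).
apply: trinomial_le => // a b _; rewrite -ltNge /counts_stat /quantile_bound.
rewrite ltr_pM2l ?divr_gt0 ?exprn_gt0// => /lt_le_trans; apply.
by rewrite lerBlDr lerDl.
Qed.

(** The range [u < 2] is chosen because [u_alpha] is only known to be at most 1, so the level 1 can
    occur when [j = 0] and [J = 1]. *)
Lemma qlam_le j k n u : (k < 2 ^ j)%N -> 0 < u < 2 ->
  qlam L N X P n (j, k) u <= quantile_bound j n u.
Proof.
move=> kj /[dup] u02 /andP[u0 u2]; rewrite /qlam; set S := [set t | _].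
have l0 : 0 <= ln (2 / u) by rewrite ln_ge0// ler_pdivlMr// mul1r ltW.
have qb0 : 0 <= quantile_bound j n u.
  by rewrite /quantile_bound !mulr_ge0 ?addr_ge0 ?invr_ge0 ?exprn_ge0 ?mulr_ge0
    ?invr_ge0 ?exprn_ge0// ltW.
(* For u >= 1 the set S is not bounded below, and then its infimum is 0. *)
have [[_ lbS]|/inf_out ->//] := pselect (has_inf S).
by apply: ge_inf => //; exact: null_cdf_quantile_bound.
Qed.

(* The statistic takes finitely many values, so some t in the set defining the
   quantile lies below all of its values above the quantile. *)
Lemma qlam_tail j k n u : (k < 2 ^ j)%N -> 0 < u < 1 ->
  trinomial n (2 ^- j)
    (fun a b => qlam L N X P n (j, k) u < counts_stat L j a b) <= u.
Proof.
move=> kj /andP[u0 u1]; rewrite /qlam; set S := [set t | _].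
have S0 : S !=set0.
  exists (quantile_bound j n u); apply: null_cdf_quantile_bound => //; lra.
pose I := iota 0 n.+1.
have [y qy yI] := seq_gap (inf S) [seq counts_stat L j a b | a <- I, b <- I].
have [t St ty] := inf_lt S0 qy.
apply: (@le_trans _ _ (trinomial n (2 ^- j)
    (fun a b => ~~ (counts_stat L j a b <= t)))).
  apply: trinomial_le => // a b abn qs; rewrite -ltNge (lt_le_trans ty)// yI//.
  by apply: allpairs_f; rewrite mem_iota/= add0n ltnS (leq_trans _ abn)//
    ?leq_addr ?leq_addl.
by rewrite trinomialN; move: St; rewrite /S/= null_cdfE//; lra.
Qed.

Lemma null_cprob_tail s j k n u : (k < 2 ^ j)%N -> 0 < u < 1 ->
  (S0 `&` intensity) s ->
  fine (P s ([set w | qlam L N X P n (j, k) u < Tstat L N X (j, k) w] `&`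
             [set w | N w = n])) <= fine (P s [set w | N w = n]) * u.
Proof.
move=> kj u01 sN; have [c c0 sc] := null_intensity sN.
set q := qlam _ _ _ _ _ _ _.
have -> : [set w | q < Tstat L N X (j, k) w] `&` [set w | N w = n] =
    [set w | q < counts_stat L j (countl j k w) (countr j k w) /\ N w = n].
  by apply/seteqP; split => w /=; rewrite TstatE.
rewrite (null_trinomial n (fun a b => q < counts_stat L j a b) kj sN.2 c0 sc).
by rewrite ler_wpM2l ?fine_ge0// qlam_tail.
Qed.

Variable J : nat.
Hypothesis J0 : (0 < J)%N.

(** The real [sup] is 0 on empty or unbounded sets. The value 0 is harmless for the direct
    implication; the converse uses that [Lambda J] is finite, so the set is bounded above. *)
Lemma Tsup_gt0P n u w : (0 < Tsup L N X P J n u w) <->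
  exists j k, [/\ (j < J)%N, (k < 2 ^ j)%N &
    qlam L N X P n (j, k) (u / (2 ^+ j * J%:R)) < Tstat L N X (j, k) w].
Proof.
rewrite /Tsup; set S := [set _ | _ in _]; split.
  have [->|/set0P Sn0] := eqVneq S set0; first by rewrite sup0 ltxx.
  move=> /(sup_gt Sn0)[_ [[j k] [/= jJ kj] <-]]; rewrite subr_gt0 => h.
  by exists j, k.
move=> [j [k [jJ kj qT]]].
pose f lam := Tstat L N X lam w - qlam L N X P n lam (u / (2 ^+ lam.1 * J%:R)).
apply: (@lt_le_trans _ _ (f (j, k))); first by rewrite subr_gt0.
apply: ub_le_sup; last by exists (j, k).
have [y yub] := seq_ubound [seq f (j, k) | j <- iota 0 J, k <- iota 0 (2 ^ j)].
exists y => _ [[j' k'] [/= j'J k'j'] <-]; apply: yub.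
by apply: allpairs_f_dep; rewrite mem_iota.
Qed.

Lemma measurable_Tstat_gt j k (q : R) : measurable [set w | q < Tstat L N X (j, k) w].
Proof.
rewrite (_ : [set w | _] =
    [set w | q < counts_stat L j (countl j k w) (countr j k w)]).
  exact: (measurable_counts j k (fun a b => q < counts_stat L j a b)).
by apply/seteqP; split => w /=; rewrite TstatE.
Qed.

Let rejects n u : nat -> nat -> set Omega := fun j k =>
  [set w | qlam L N X P n (j, k) (u / (2 ^+ j * J%:R)) < Tstat L N X (j, k) w] `&`
  [set w | N w = n].

Let measurable_rejects n u j k : measurable (rejects n u j k).
Proof.
apply: measurableI; first exact: measurable_Tstat_gt.
exact: (measurable_N model_point_process).
Qed.

Lemma TsupE n u : [set w | 0 < Tsup L N X P J n u w] `&` [set w | N w = n] =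
  \big[setU/set0]_(j < J) \big[setU/set0]_(k < 2 ^ j) rejects n u j k.
Proof.
rewrite -(bigcup_mkord J (fun j => \big[setU/set0]_(k < 2 ^ j) rejects n u j k)).
under eq_bigcupr do rewrite -bigcup_mkord.
apply/seteqP; split => w.
  move=> [/Tsup_gt0P[j [k [jJ kj qT]]] Nw].
  by exists j => //; exists k.
by move=> [j /= jJ [k /= kj [qT Nw]]]; split => //; apply/Tsup_gt0P; exists j, k.
Qed.

Lemma measurable_Tsup n u :
  measurable ([set w | 0 < Tsup L N X P J n u w] `&` [set w | N w = n]).
Proof.
rewrite TsupE; apply: bigsetU_measurable => j _.
by apply: bigsetU_measurable => k _; exact: measurable_rejects.
Qed.

(** Union bound: at each of the [J] levels, [2 ^ j] positions carry the level [u / (2 ^+ j * J)],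
    which adds up to [u]. *)
Lemma null_cprob_Tsup s n u : 0 < u < 1 -> (S0 `&` intensity) s ->
  cprob (P s) [set w | 0 < Tsup L N X P J n u w] [set w | N w = n] <= u.
Proof.
move=> /andP[u0 u1] sN; rewrite /cprob.
have mN := measurable_N model_point_process n.
have [W0|W0] := eqVneq (fine (P s [set w | N w = n])) 0.
  by rewrite W0 invr0 mulr0 ltW.
rewrite ler_pdivrMr ?lt_neqAle 1?eq_sym ?W0 ?fine_ge0//.
have Jr : 0 < J%:R :> R by rewrite ltr0n.
rewrite TsupE -lee_fin fineK; last first.
  by apply: fin_num_measure; rewrite -TsupE; exact: measurable_Tsup.
apply: le_trans (@Boole_inequality _ _ _ (P s)
    (fun j => \big[setU/set0]_(k < 2 ^ j) rejects n u j k) J _) _.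
  by move=> j _; apply: bigsetU_measurable => k _; exact: measurable_rejects.
apply: (@le_trans _ _ (\sum_(j < J) (u / J%:R * fine (P s [set w | N w = n]))%:E)%E).
  apply: lee_sum => j _.
  apply: le_trans (@Boole_inequality _ _ _ (P s) (rejects n u j) (2 ^ j) _) _.
    by move=> k _; exact: measurable_rejects.
  apply: (@le_trans _ _ (\sum_(k < 2 ^ j)
      (fine (P s [set w | N w = n]) * (u / (2 ^+ j * J%:R)))%:E)%E).
    apply: lee_sum => k _; rewrite -[leLHS]fineK ?fin_num_measure// lee_fin.
    apply: null_cprob_tail => //.
    rewrite divr_gt0 ?mulr_gt0 ?exprn_gt0//= ltr_pdivrMr ?mulr_gt0 ?exprn_gt0//.
    rewrite (lt_le_trans u1)// mul1r -[leLHS]mul1r ler_pM// ?ler1n//.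
    by rewrite exprn_ege1// ler1n.
  rewrite sumEFin lee_fin sumr_const card_ord -[(_ * _) *+ (2 ^ j)]mulr_natr natrX.
  rewrite le_eqVlt; apply/orP; left; apply/eqP; field.
  by rewrite gt_eqF// expf_neq0.
rewrite sumEFin lee_fin sumr_const card_ord -[(_ * _) *+ J]mulr_natr.
by rewrite mulrAC mulrVK// unitfE gt_eqF.
Qed.

Lemma u_alpha_itv n alpha : 0 < alpha < 1 ->
  alpha <= u_alpha L N X P J alpha n <= 1.
Proof.
move=> /andP[a0 a1]; rewrite /u_alpha; set S := [set u | _].
have Sa : S alpha.
  split; first by rewrite a0.
  apply: ge_sup.
    exists (cprob (P (cst 1)) [set w | 0 < Tsup L N X P J n alpha w] [set w | N w = n]).
    exists (cst 1) => //; split; last exact: intensity_cst ler01.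
    by exists 1.
  by move=> _ [s sN <-]; apply: null_cprob_Tsup => //; rewrite a0.
have S1 : ubound S 1 by move=> u [/andP[_ /ltW]].
by rewrite ub_le_sup//=; [apply: ge_sup => //; exists alpha|exists 1].
Qed.

(** The critical values depend on [N], so the rejection event is cut along the values of [N]; on
    each piece it is a finite union. *)
Lemma measurable_Phi2 alpha :
  measurable [set w | Phi2 L N X P J alpha w = false].
Proof.
rewrite (_ : [set w | _] = ~` \bigcup_n
    ([set w | 0 < Tsup L N X P J n (u_alpha L N X P J alpha n) w] `&`
     [set w | N w = n])).
  by apply: measurableC; apply: bigcupT_measurable => n; exact: measurable_Tsup.
apply/seteqP; split => w /=; rewrite /Phi2 /T2.
  by move=> /negbT/negP Tw [n _ [/= ? Nw]]; apply: Tw; rewrite Nw.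
by move=> h; apply/negP => Tw; apply: h; exists (N w).
Qed.

(** Acceptance puts every statistic below its critical value. As [quantile_bound] decreases in the
    level, the implicit [u_alpha >= alpha] may be replaced by [alpha]. *)
Lemma Phi2_false_le alpha j k w : 0 < alpha < 1 -> (j < J)%N -> (k < 2 ^ j)%N ->
  Phi2 L N X P J alpha w = false ->
  counts_stat L j (countl j k w) (countr j k w) <=
  quantile_bound j (N w) (alpha / (2 ^+ j * J%:R)).
Proof.
move=> a01 jJ kj /negP Tw; rewrite -TstatE leNgt; apply/negP => qT; apply: Tw.
apply/Tsup_gt0P; exists j, k; split => //; apply: le_lt_trans qT.
have /andP[au u1] := u_alpha_itv (N w) a01.
have /andP[a0 a1] := a01.
set v := 2 ^+ j * J%:R.
have v1 : 1 <= v.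
  by rewrite -[leLHS]mul1r ler_pM// ?exprn_ege1 ?ler1n.
have v0 : 0 < v by rewrite (lt_le_trans ltr01).
have u0 := lt_le_trans a0 au.
apply: le_trans (qlam_le _ kj _) _.
  rewrite divr_gt0//= ltr_pdivrMr//; lra.
rewrite /quantile_bound.
have lle : ln (2 / (u_alpha L N X P J alpha (N w) / v)) <= ln (2 / (alpha / v)).
  rewrite ler_ln ?posrE ?divr_gt0//.
  by rewrite ler_pM2l// lef_pV2 ?posrE ?divr_gt0// ler_pM2r// invr_gt0.
have l0 : 0 <= ln (2 / (u_alpha L N X P J alpha (N w) / v)).
  by rewrite ln_ge0// ler_pdivlMr ?divr_gt0// mul1r ler_pdivrMr//; lra.
rewrite ler_wpM2l ?divr_ge0 ?exprn_ge0 ?(ltW L0)//.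
have np0 : 0 <= (N w)%:R * 2 ^- j :> R.
  by rewrite mulr_ge0// invr_ge0 exprn_ge0.
by apply: ler_pM; rewrite ?addr_ge0 ?mulr_ge0 ?lerD2l ?ler_pM2l.
Qed.

End NullTest.

(** * Power at a large Haar coefficient *)

Section Jbar.
Context {R : realType}.
Variable L : R.
Hypothesis lnL1 : 1 <= ln L.

Lemma ln_ge1_gt0 : 0 < L.
Proof. by rewrite ltNge; apply/negP => /ln0 L0; move: lnL1; rewrite L0 ler10. Qed.

(** With l = ln L, write L = e * e^(l - 1), where e >= 2 and e^(l - 1) >= l. The factor 2 is what
    makes [Jbar L] positive. *)
Lemma ln_ge1_le : 2 * ln L <= L.
Proof.
rewrite -[leRHS]lnK ?posrE ?ln_ge1_gt0//; set l := ln L.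
rewrite -[l in expR l](subrK 1) expRD mulrC ler_pM//; first by rewrite (le_trans ler01).
  by have := expR_ge1Dx (l - 1); rewrite addrC subrK.
by have := expR_ge1Dx (1 : R); lra.
Qed.

Lemma Jbar_bounds : [/\ (0 < Jbar L)%N, 2 ^+ Jbar L <= L / ln L &
  L / ln L < 2 ^+ (Jbar L).+1].
Proof.
have L0 := ln_ge1_gt0; have l0 : 0 < ln L by rewrite (lt_le_trans ltr01).
set y := L / ln L; have y2 : 2 <= y by rewrite ler_pdivlMr// ln_ge1_le.
have y0 : 0 < y by rewrite (lt_le_trans _ y2).
have ln2 : 0 < ln 2 :> R by rewrite ln_gt0// ltr1n.
have pow2 n : 2 ^+ n = expR (n%:R * ln 2) :> R by rewrite expRM_natl lnK ?posrE.
have /truncn_itv/andP[] : 0 <= ln y / ln 2.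
  by rewrite divr_ge0 ?ltW// ln_gt0// (lt_le_trans _ y2)// ltr1n.
rewrite -/(Jbar L) ler_pdivlMr// ltr_pdivrMr// => h1 h2.
have yl : 2 ^+ Jbar L <= y by rewrite pow2 -[leRHS]lnK ?posrE// ler_expR.
have yr : y < 2 ^+ (Jbar L).+1 by rewrite pow2 -[ltLHS]lnK ?posrE// ltr_expR.
split => //; have := le_lt_trans y2 yr.
by rewrite -[ltLHS]expr1 ltr_eXn2l ?ltr1n.
Qed.

End Jbar.

Section Power.
Context {R : realType}.
Local Notation mu := (@lebesgue_measure R).

(** The summand 2 pays for ln (2^j) and ln Jbar, each at most ln L, in the logarithm of 2 / alpha *
    2^j * Jbar. *)
Definition log_const (alpha : R) : R := ln (2 / alpha) + 2.

(* The signal-to-noise ratio at which a Haar coefficient is detected; 3 / beta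
   comes from Chebyshev's inequality for three counts at level beta / 3. *)
Definition detection_const (alpha beta M : R) : R :=
  16 * (3 / beta) * M + 4 * (3 * M + 3 / beta +
    8 * log_const alpha * (2 * M + 3 / beta + log_const alpha)).

Lemma log_const_gt0 alpha : 0 < alpha < 1 -> 0 < log_const alpha.
Proof.
move=> /andP[a0 a1]; rewrite /log_const ltr_wpDl// ln_ge0// ler_pdivlMr//; lra.
Qed.

Lemma detection_const_gt0 alpha beta M :
  0 < alpha < 1 -> 0 < beta < 1 -> 0 < M -> 0 < detection_const alpha beta M.
Proof.
move=> /log_const_gt0 c0 /andP[b0 _] M0.
have k0 : 0 < 3 / beta by rewrite divr_gt0.
rewrite /detection_const; move: (3 / beta) k0 => k k0.
by do ?[apply: addr_gt0 => //|apply: mulr_gt0 => //].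
Qed.

Lemma ln_level_le (alpha L : R) j J : 0 < alpha < 1 -> 1 <= ln L ->
  (0 < J)%N -> 2 ^+ j <= L -> 2 ^+ J <= L ->
  0 <= ln (2 / (alpha / (2 ^+ j * J%:R))) <= log_const alpha * ln L.
Proof.
move=> /andP[a0 a1] l1 J0 jL JL; have L0 := ln_ge1_gt0 l1.
have Jr : 0 < J%:R :> R by rewrite ltr0n.
have p0 : 0 < 2 ^+ j :> R by rewrite exprn_gt0.
have la : 0 <= ln (2 / alpha) by rewrite ln_ge0// ler_pdivlMr//; lra.
have -> : 2 / (alpha / (2 ^+ j * J%:R)) = 2 / alpha * 2 ^+ j * J%:R.
  by field; rewrite !gt_eqF.
have q0 : 0 < 2 / alpha by rewrite divr_gt0.
rewrite /log_const; move: (2 / alpha) q0 la => q q0 la.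
rewrite !lnM ?posrE ?mulr_gt0//.
have lj : ln (2 ^+ j) <= ln L by rewrite ler_ln ?posrE.
have lJ : ln (J%:R) <= ln L.
  rewrite ler_ln ?posrE// (le_trans _ JL)// -natrX ler_nat.
  exact/ltnW/ltn_expl.
have lj0 : 0 <= ln (2 ^+ j : R) by rewrite ln_ge0// exprn_ege1// ler1n.
have lJ0 : 0 <= ln (J%:R : R) by rewrite ln_ge0// ler1n.
have : 0 <= ln q * (ln L - 1) by rewrite mulr_ge0 ?subr_ge0.
by move=> ?; apply/andP; split; lra.
Qed.

(** Here x = L 2^-j, l = ln L, a and b are the means of the counts A and B, Np = N 2^-j, and h is
    the logarithm in the critical value. The first summand of [detection_const] makes [a - b] at
    least 4 Chebyshev radii, so [A - B] keeps half of it; the second makes a quarter of its square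
    exceed A + B plus the critical value. *)
Lemma detection_arith (alpha beta M x l a b A B Np h : R) :
  0 < alpha < 1 -> 0 < beta < 1 -> 0 < M -> 1 <= l -> l <= x ->
  0 <= a <= M * x -> 0 <= b <= M * x ->
  detection_const alpha beta M * (x * l) < (a - b) ^+ 2 ->
  `|A - a| < Num.sqrt (3 / beta * (M * x)) ->
  `|B - b| < Num.sqrt (3 / beta * (M * x)) ->
  0 <= Np <= (2 * M + 3 / beta) * x ->
  0 <= h <= log_const alpha * l ->
  8 * h * (Np + h) < (A - B) ^+ 2 - (A + B).
Proof.
move=> a01 /[dup] b01 /andP[b0 _] M0 l1 lx ax bx ab Aa Bb Npx hl.
have c0 := log_const_gt0 a01.
have := detection_const_gt0 a01 b01 M0.
move: ab Aa Bb Npx; rewrite /detection_const; set k := 3 / beta.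
have k0 : 0 < k by rewrite divr_gt0.
set c := log_const alpha in c0 hl *; clearbody c k.
move=> ab Aa Bb Npx K0.
have x0 : 0 < x by lra.
have l0 : 0 < l by lra.
have Mx0 : 0 < M * x by rewrite mulr_gt0.
set v := Num.sqrt _ in Aa Bb.
have v0 : 0 <= v by exact: sqrtr_ge0.
have v2 : v ^+ 2 = k * (M * x) by rewrite sqr_sqrtr// mulr_ge0// ltW.
have xl : x <= x * l by rewrite ler_peMr// ltW.
have S0 : 0 < 3 * M + k + 8 * c * (2 * M + k + c).
  by do ?[apply: addr_gt0 => //|apply: mulr_gt0 => //].
set S := 3 * M + k + _ in ab K0 S0.
have D16 : (4 * v) ^+ 2 <= (a - b) ^+ 2.
  rewrite exprMn v2; apply: le_trans (ltW ab).
  rewrite mulrDl -[leLHS]addr0 lerD//; last by do ?[apply: mulr_ge0 => //]; exact: ltW.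
  rewrite (_ : 4 ^+ 2 * (k * (M * x)) = 16 * k * M * x); last by ring.
  by apply: ler_wpM2l => //; do ?[apply: mulr_ge0 => //]; exact: ltW.
have D4 : 4 * v <= `|a - b|.
  by rewrite -(ler_pXn2r (n := 2)) ?nnegrE ?mulr_ge0// real_normK ?num_real.
have AB : `|a - b| / 2 <= `|A - B|.
  have : `|a - b| <= `|A - B| + `|A - a| + `|B - b|.
    rewrite (_ : a - b = (A - B) - (A - a) + (B - b)); last by ring.
    apply: le_trans (ler_normD _ _) _; rewrite lerD2r.
    exact: ler_normB.
  by lra.
have AB2 : (a - b) ^+ 2 / 4 <= (A - B) ^+ 2.
  have : (`|a - b| / 2) ^+ 2 <= `|A - B| ^+ 2.
    by rewrite lerXn2r ?nnegrE ?divr_ge0.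
  by rewrite expr_div_n !real_normK ?num_real// -natrX.
(* Arithmetic-geometric mean inequality, since [v] is the square root of [k * (M * x)]. *)
have v2k : 2 * v <= k + M * x.
  rewrite -(ler_pXn2r (n := 2)) ?nnegrE ?mulr_ge0 ?addr_ge0// ?(ltW k0) ?(ltW Mx0)//.
  rewrite exprMn v2; have := sqr_ge0 (k - M * x); nra.
have ABs : A + B <= (3 * M + k) * (x * l).
  move: Aa Bb; rewrite !ltr_norml => /andP[_ Aa] /andP[_ Bb].
  have kx : k <= k * (x * l) by rewrite ler_peMr ?(ltW k0)// ; nra.
  have Mxl : M * x <= M * (x * l) by rewrite ler_pM2l.
  lra.
(* The hypothesis [l <= x] is what bounds the quadratic term [h ^+ 2] by [c ^+ 2 * (x * l)]. *)
have hq : 8 * h * (Np + h) <= 8 * c * (2 * M + k + c) * (x * l).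
  have hx : h <= c * x by rewrite (le_trans (proj2 (andP hl)))// ler_pM2l.
  rewrite (_ : 8 * c * (2 * M + k + c) * (x * l) =
    8 * (c * l) * ((2 * M + k) * x + c * x)); last by ring.
  case/andP: hl => h0 hl; case/andP: Npx => N0 Npx.
  by rewrite ler_pM ?mulr_ge0 ?addr_ge0 ?ler_pM2l ?lerD.
have Kl : 4 * S * (x * l) < (a - b) ^+ 2.
  apply: le_lt_trans ab; rewrite [leRHS]mulrDl lerDr.
  by do ?[apply: mulr_ge0 => //]; exact: ltW.
move: Kl; rewrite /S; lra.
Qed.

Lemma count_bound_arith (k M L m n : R) : 0 < k -> 0 < M -> 1 <= L ->
  m <= M * L -> `|n - m| < Num.sqrt (k * (M * L)) -> n <= (2 * M + k) * L.
Proof.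
move=> k0 M0 L1 mM; rewrite ltr_norml => /andP[_ nm].
have ML0 : 0 < M * L by rewrite mulr_gt0//; lra.
have sq : Num.sqrt (k * (M * L)) <= k + M * L.
  rewrite -[leRHS]ger0_norm ?addr_ge0 ?(ltW k0) ?(ltW ML0)//.
  rewrite -sqrtr_sqr ler_sqrt ?sqr_ge0//; nra.
have kL : k <= k * L by rewrite ler_peMr// ltW.
lra.
Qed.

Context {d : measure_display} {Omega : measurableType d}.

Lemma poisson_process_chebyshev (Q : probability Omega R) N X nu (A : set R) (k Y : R) :
  poisson_process Q N X nu -> measurable A -> A `<=` I01 -> 0 < k -> 0 < Y ->
  0 <= nu A <= Y ->
  (Q [set w | (Num.sqrt (k * Y) <= `|(count_in N X A w)%:R - nu A|)%R] <=
   (k^-1)%:E)%E.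
Proof.
move=> [_ cA _] mA AI k0 Y0 /andP[nu0 nuY].
rewrite (cA A mA AI [set m | Num.sqrt (k * Y) <= `|m%:R - nu A|]).
apply: le_trans (poisson_chebyshev nu0 _) _; first by rewrite sqrtr_gt0 mulr_gt0.
rewrite lee_fin sqr_sqrtr ?mulr_ge0 ?(ltW k0) ?(ltW Y0)//.
by rewrite invfM mulrCA ler_piMr ?invr_ge0 ?(ltW k0)// ler_pdivrMr// mul1r.
Qed.

Lemma Phi2_power (L alpha beta M : R) N X (P : (R -> R) -> probability Omega R)
    (s : R -> R) j k :
  1 <= ln L -> 0 < alpha < 1 -> 0 < beta < 1 -> 0 < M ->
  poisson_model L N X P -> intensity s -> bounded_by M s ->
  (j < Jbar L)%N -> (k < 2 ^ j)%N ->
  detection_const alpha beta M * (ln L / L) < coef s (j, k) ^+ 2 ->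
  (P s [set w | Phi2 L N X P (Jbar L) alpha w = false] <= beta%:E)%E.
Proof.
move=> l1 a01 /[dup] b01 /andP[b0 b1] M0 mP si sM jJ kj cK.
have L1 : 1 <= L by have := ln_ge1_le l1; lra.
have thirds : beta / 3 + beta / 3 + beta / 3 <= beta by lra.
have [J0 JL LJ] := Jbar_bounds l1; have L0 := ln_ge1_gt0 l1.
have l0 : 0 < ln L by rewrite (lt_le_trans ltr01).
have [[ms _] s0] := si.
pose A : set R := dyadic j.+1 k.*2; pose B : set R := dyadic j.+1 k.*2.+1.
have [mA mB] : measurable A /\ measurable B by split; exact: measurable_dyadic.
have [AI BI] := dyadic_half_sub (R := R) kj.
have [kl kr] := ltn_half_dyadic kj.
pose x := L * 2 ^- j.
have p0 : 0 < 2 ^+ j :> R by rewrite exprn_gt0.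
have x0 : 0 < x by rewrite divr_gt0.
have cellb k' : (k' < 2 ^ j.+1)%N -> 0 <= L * cell s j.+1 k' <= M * x.
  move=> k'j; rewrite mulr_ge0 ?(ltW L0)//=; last first.
    by apply: Rintegral_ge0 => y /(dyadic_sub k'j); exact: s0.
  rewrite mulrCA ler_pM2l// (le_trans (ler_norm _))//.
  apply: le_trans (normr_cell_le ms sM k'j) _.
  by rewrite ler_pM2l// lef_pV2 ?posrE ?exprn_gt0// exprS ler_peMl ?ler1n ?(ltW p0).
have b30 : 0 < 3 / beta by rewrite divr_gt0.
pose bad Y (c : Omega -> nat) (m : R) :=
  [set w | Num.sqrt (3 / beta * Y) <= `|(c w)%:R - m|].
pose bad1 := bad (M * x) (count_in N X A) (L * cell s j.+1 k.*2).
pose bad2 := bad (M * x) (count_in N X B) (L * cell s j.+1 k.*2.+1).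
pose bad3 := bad (M * L) N (L * \int[mu]_(y in I01) s y).
have pp := model_point_process mP.
have mbad Y c m : measurable_nat c -> measurable (bad Y c m).
  move=> mc; apply: (measurable_nat_pair
    (fun a _ => Num.sqrt (3 / beta * Y) <= `|a%:R - m|) mc mc).
have [mb1 mb2 mb3] : [/\ measurable bad1, measurable bad2 & measurable bad3].
  by split; apply: mbad;
    [exact: measurable_count|exact: measurable_count|exact: measurable_N pp].
have Mx0 : 0 < M * x by rewrite mulr_gt0.
have e3 : (3 / beta)^-1 = beta / 3 by rewrite invf_div.
have Pb1 : (P s bad1 <= (beta / 3)%:E)%E.
  by rewrite -e3; apply: (poisson_process_chebyshev (mP s si)) => //; exact: cellb.
have Pb2 : (P s bad2 <= (beta / 3)%:E)%E.
  by rewrite -e3; apply: (poisson_process_chebyshev (mP s si)) => //; exact: cellb.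
have intb : 0 <= L * \int[mu]_(y in I01) s y <= M * L.
  rewrite mulr_ge0 ?(ltW L0) ?Rintegral_ge0//= mulrC ler_pM2r//.
  rewrite -[leRHS]Rintegral_cst_I01; apply: le_Rintegral.
  - exact: measurable_I01.
  - exact: integrable_bounded sM.
  - by apply: (@integrable_bounded _ (cst M) `|M|) => //; exact: measurable_cst.
  - by move=> y Iy; rewrite (le_trans (ler_norm _))// sM.
have Pb3 : (P s bad3 <= (beta / 3)%:E)%E.
  rewrite -e3; apply: le_trans (poisson_process_chebyshev (A := I01) (mP s si) _ _ b30 _ intb).
  - apply: le_measure; rewrite ?inE//.
      apply: (mbad _ (count_in N X I01)).
      by apply: measurable_count => //; exact: measurable_I01.
    by move=> w /=; rewrite /bad3 /bad/= (count_in_I01 pp).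
  - exact: measurable_I01.
  - by [].
  - by rewrite mulr_gt0.
apply: (@le_trans _ _ (P s (bad1 `|` bad2 `|` bad3))); last first.
  apply: le_trans (measureU2 _ _ _) _ => //; first exact: measurableU.
  apply: (@le_trans _ _ ((beta / 3 + beta / 3)%:E + (beta / 3)%:E)%E).
    apply: (leeD _ Pb3); apply: le_trans (measureU2 _ mb1 mb2) _.
    exact: (leeD Pb1 Pb2).
  by rewrite -EFinD lee_fin.
apply: le_measure; rewrite ?inE.
- exact: measurable_Phi2.
- by apply: measurableU => //; exact: measurableU.
move=> w /= /(Phi2_false_le L0 mP J0 a01 jJ kj); apply: contraPP => nbad.
have jL : 2 ^+ j <= L / ln L.
  by rewrite (le_trans _ JL)// ler_eXn2l ?ltr1n// ltnW.
have yL : L / ln L <= L by rewrite ler_pdivrMr// ler_peMr// ltW.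
(* The upper bound on the resolution in the choice of [Jbar] is used here. *)
have lx : ln L <= x by rewrite /x ler_pdivlMr// mulrC -ler_pdivlMr.
have nb1 : `|(count_in N X A w)%:R - L * cell s j.+1 k.*2| < Num.sqrt (3 / beta * (M * x)).
  by rewrite ltNge; apply/negP => h; apply: nbad; left; left.
have nb2 : `|(count_in N X B w)%:R - L * cell s j.+1 k.*2.+1| < Num.sqrt (3 / beta * (M * x)).
  by rewrite ltNge; apply/negP => h; apply: nbad; left; right.
have nb3 : `|(N w)%:R - L * \int[mu]_(y in I01) s y| < Num.sqrt (3 / beta * (M * L)).
  by rewrite ltNge; apply/negP => h; apply: nbad; right.
have Nx : 0 <= ((N w)%:R * 2 ^- j : R) <= (2 * M + 3 / beta) * x.
  rewrite mulr_ge0 ?invr_ge0 ?(ltW p0)//= mulrA ler_pM2r ?invr_gt0//.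
  exact: (count_bound_arith b30 M0 L1 (proj2 (andP intb)) nb3).
have cD : detection_const alpha beta M * (x * ln L) <
    (L * cell s j.+1 k.*2 - L * cell s j.+1 k.*2.+1) ^+ 2.
  rewrite -mulrBr exprMn.
  move: cK; rewrite (coef_cell ms sM kj) exprMn sqr_pow2_half.
  (* This factor passes from coefficients to expected counts: the squared coefficient becomes the
     squared difference of means, and ln L / L becomes [x * ln L]. *)
  rewrite -(ltr_pM2l (x := L ^+ 2 / 2 ^+ j)) ?divr_gt0 ?exprn_gt0//.
  set D := _ - _.
  rewrite (_ : L ^+ 2 / 2 ^+ j * (2 ^+ j * D ^+ 2) = L ^+ 2 * D ^+ 2); last first.
    by field; rewrite gt_eqF.
  congr (_ < _); rewrite /x; field; rewrite !gt_eqF//.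
have hl := ln_level_le a01 l1 J0 (le_trans jL yL) (le_trans JL yL).
have := detection_arith a01 b01 M0 l1 lx (cellb _ kl) (cellb _ kr) cD nb1 nb2 Nx hl.
rewrite /counts_stat /quantile_bound ler_pM2l ?divr_gt0 ?exprn_gt0//.
by rewrite -natrD => /lt_geF ->.
Qed.

End Power.

(** * Separation rate *)

Section Main.
Context {R : realType}.

(** The first summand comes from the weak Besov bound at the threshold K ln L / L. The second is the
    geometric Besov tail, whose numerator pays for rounding down in [Jbar]. *)
Definition separation_const (alpha beta M delta gamma : R) : R :=
  detection_const alpha beta M `^ (2 * gamma / (1 + 2 * gamma)) +
  2 `^ (2 * delta) / (1 - 2 `^ (- (2 * delta))).

Lemma separation_const_gt0 alpha beta M delta gamma :
  0 < alpha < 1 -> 0 < beta < 1 -> 0 < M -> 0 < delta ->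
  0 < separation_const alpha beta M delta gamma.
Proof.
move=> a01 b01 M0 d0; rewrite ltr_wpDr ?powR_gt0 ?detection_const_gt0//.
by rewrite divr_ge0 ?powR_ge0// subr_ge0 ltW// pow2N_lt1.
Qed.

Lemma pow2_Jbar_le (L delta : R) : 1 <= ln L -> 0 < delta ->
  (2 `^ (- (2 * delta))) ^+ Jbar L <= 2 `^ (2 * delta) * (ln L / L) `^ (2 * delta).
Proof.
move=> l1 d0; have L0 := ln_ge1_gt0 l1.
have l0 : 0 < ln L by rewrite (lt_le_trans ltr01).
have [_ _ /ltW LJ] := Jbar_bounds l1.
have r0 : 0 <= ln L / L by rewrite divr_ge0 ?(ltW l0) ?(ltW L0).
have -> : (2 `^ (- (2 * delta))) ^+ Jbar L = ((2 ^+ Jbar L) `^ (2 * delta))^-1 :> R.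
  by rewrite -powR_mulrn ?powR_ge0// -powRrM -powRN -[2 ^+ _]powR_mulrn// -powRrM mulrC.
rewrite -[leLHS]mul1r ler_pdivrMr ?powR_gt0 ?exprn_gt0//.
have r20 : 0 <= 2 * (ln L / L) by rewrite mulr_ge0.
rewrite -powRM// -powRM ?exprn_ge0//.
rewrite [leLHS](_ : 1 = 1 `^ (2 * delta)); last by rewrite powR1.
apply: ge0_ler_powR; rewrite ?nnegrE//.
- by rewrite mulr_ge0// ltW.
- by rewrite mulr_ge0 ?exprn_ge0.
move: LJ; rewrite exprS ler_pdivrMr// => LJ.
rewrite (_ : 2 * (ln L / L) * 2 ^+ Jbar L = 2 * 2 ^+ Jbar L * ln L / L).
  by rewrite ler_pdivlMr// mul1r.
by rewrite mulrAC -!mulrA.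
Qed.

Lemma separation_arith (Ke re ra p qJ i A B : R) :
  0 <= Ke -> 0 <= re -> 0 <= ra -> 0 <= p -> 0 <= i -> 0 <= A -> 0 <= B ->
  qJ <= p * ra ->
  B * (Ke * re) + A * (qJ * i) <= (Ke + p * i) * (A * ra + B * re).
Proof.
move=> Ke0 re0 ra0 p0 i0 A0 B0 h.
have : 0 <= A * i * (p * ra - qJ) by rewrite !mulr_ge0// subr_ge0.
have : 0 <= Ke * A * ra by rewrite !mulr_ge0.
have : 0 <= p * i * B * re by rewrite !mulr_ge0.
lra.
Qed.

(** Common source of both assertions of the theorem, with an explicit constant that does not involve
    [Rad] or [Rad']. *)
Lemma Phi2_separation (L alpha beta M delta gamma Rad Rad' : R)
    (d : measure_display) (Omega : measurableType d)
    (N : Omega -> nat) X (P : (R -> R) -> probability Omega R) (s : R -> R) :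
  1 <= ln L -> 0 < alpha < 1 -> 0 < beta < 1 -> 0 < M -> 0 < delta ->
  poisson_model L N X P ->
  (besov delta Rad `&` weak_besov gamma Rad' `&` bounded_by M) s ->
  separation_const alpha beta M delta gamma *
    (Rad ^+ 2 * (ln L / L) `^ (2 * delta) +
     Rad' ^+ 2 * (ln L / L) `^ (2 * gamma / (1 + 2 * gamma))) <
    dist2_set s S0 ^+ 2 ->
  (P s [set w | Phi2 L N X P (Jbar L) alpha w = false] <= beta%:E)%E.
Proof.
move=> l1 a01 b01 M0 d0 mP sB; apply: contraTT; rewrite -ltNge -leNgt => Pb.
have L0 := ln_ge1_gt0 l1; have l0 : 0 < ln L by rewrite (lt_le_trans ltr01).
have K0 := detection_const_gt0 a01 b01 M0.
have r0 : 0 < ln L / L by rewrite divr_gt0.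
set K := detection_const alpha beta M in K0 *.
have small j k : (j < Jbar L)%N -> (k < 2 ^ j)%N ->
    coef s (j, k) ^+ 2 <= K * (ln L / L).
  move=> jJ kj; rewrite leNgt; apply/negP => cK.
  have [[[si _] _] sM] := sB.
  by have := Phi2_power l1 a01 b01 M0 mP si sM jJ kj cK; rewrite leNgt Pb.
have t0 : 0 < K * (ln L / L) by rewrite mulr_gt0.
apply: le_trans (dist2_S0_thresholded d0 t0 sB small) _.
rewrite /separation_const -/K.
have q1 := pow2N_lt1 d0; have pJ := pow2_Jbar_le l1 d0.
set q := 2 `^ (- _) in q1 pJ *.
have q10 : 0 < 1 - q by rewrite subr_gt0.
rewrite powRM ?(ltW K0) ?(ltW r0)//.
by apply: separation_arith; rewrite ?powR_ge0 ?sqr_ge0 ?invr_ge0 ?(ltW q10).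
Qed.

End Main.

Theorem proposition2 (R : realType) :
  (forall (alpha beta Rad'' delta gamma : R),
     0 < alpha < 1 -> 0 < beta < 1 -> 0 < Rad'' -> 0 < delta -> 0 < gamma ->
     exists C : R, 0 < C /\
       forall (L Rad Rad' : R), 1 <= ln L -> 0 < Rad -> 0 < Rad' ->
       forall (d : measure_display) (Omega : measurableType d)
         (N : Omega -> nat) (X : nat -> Omega -> R)
         (P : (R -> R) -> probability Omega R),
       poisson_model L N X P ->
       forall s : R -> R,
       (besov delta Rad `&` weak_besov gamma Rad' `&` bounded_by Rad'') s ->
       dist2_set s S0 ^+ 2 >
         C * (ln L / L
              + Rad ^+ 2 * (ln L / L) `^ (2 * delta)
              + Rad' ^+ 2 * (ln L / L) `^ (2 * gamma / (1 + 2 * gamma))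
              + Rad' `^ (2 + 4 * gamma) * (ln L / L) `^ (2 * gamma)) ->
       (P s [set w | Phi2 L N X P (Jbar L) alpha w = false] <= beta%:E)%E)
  /\
  (forall (delta gamma : R), 0 < delta -> 0 < gamma ->
     gamma / (1 + 2 * gamma) <= delta ->
     exists L0 : R, 0 < L0 /\
       forall (alpha beta Rad Rad' Rad'' : R),
       0 < alpha < 1 -> 0 < beta < 1 -> 0 < Rad -> 0 < Rad' -> 0 < Rad'' ->
       exists C : R, 0 < C /\
         forall L : R, 1 <= ln L -> L0 < L ->
         forall (d : measure_display) (Omega : measurableType d)
           (N : Omega -> nat) (X : nat -> Omega -> R)
           (P : (R -> R) -> probability Omega R),
         poisson_model L N X P ->
         (separation_rate P (Phi2 L N X P (Jbar L) alpha)
            (besov delta Rad `&` weak_besov gamma Rad' `&` bounded_by Rad'')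
            beta
          <= (C * (ln L / L) `^ (gamma / (1 + 2 * gamma)))%:E)%E).
Proof.
split=> [alpha beta M delta gamma a01 b01 M0 d0 g0|delta gamma d0 g0 gd].
  exists (separation_const alpha beta M delta gamma).
  split; first exact: separation_const_gt0.
  move=> L Rad Rad' l1 Rad0 Rad'0 d Omega N X P mP s sB ds.
  apply: (Phi2_separation l1 a01 b01 M0 d0 mP sB); apply: le_lt_trans ds.
  rewrite ler_wpM2l ?(ltW (separation_const_gt0 _ _ _ _ _))//.
  have r0 : 0 <= ln L / L by rewrite divr_ge0 ?(ltW (ln_ge1_gt0 l1))// (le_trans ler01).
  have : 0 <= Rad' `^ (2 + 4 * gamma) * (ln L / L) `^ (2 * gamma).
    by rewrite mulr_ge0 ?powR_ge0.
  lra.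
exists 1; split => // alpha beta Rad Rad' M a01 b01 R0 R'0 M0.
have C0 := separation_const_gt0 gamma a01 b01 M0 d0.
set C := separation_const _ _ _ _ _ in C0.
have S0 : 0 < Rad ^+ 2 + Rad' ^+ 2 by rewrite addr_gt0 ?exprn_gt0.
exists (Num.sqrt (C * (Rad ^+ 2 + Rad' ^+ 2))).
split; first by rewrite sqrtr_gt0 mulr_gt0.
move=> L l1 _ d Omega N X P mP.
have L0 := ln_ge1_gt0 l1; have l0 : 0 < ln L by rewrite (lt_le_trans ltr01).
have r0 : 0 < ln L / L by rewrite divr_gt0.
have r1 : ln L / L <= 1.
  by rewrite ler_pdivrMr// mul1r; have := ln_ge1_le l1; lra.
have e0 : 0 < 1 + 2 * gamma by lra.
set rho := _ * _ `^ _.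
have rho0 : 0 < rho by rewrite mulr_gt0 ?powR_gt0// sqrtr_gt0 mulr_gt0.
(* The infimum is bounded by showing that [rho] is itself admissible: [rho ^+ 2] is
   [C * (Rad ^+ 2 + Rad' ^+ 2)] times the weak Besov power of ln L / L. *)
apply: ereal_inf_lbound; exists rho => //; split => //.
apply: ub_ereal_sup => _ [s [sB /= ds] <-].
apply: (Phi2_separation l1 a01 b01 M0 d0 mP sB); rewrite -/C.
apply: (@le_lt_trans _ _ (rho ^+ 2)); last first.
  by rewrite ltr_pXn2r ?nnegrE// ltW// (lt_trans rho0).
rewrite /rho exprMn sqr_sqrtr ?mulr_ge0 ?(ltW C0) ?(ltW S0)//.
rewrite -[leRHS]mulrA ler_pM2l//.
have re : (ln L / L) `^ (gamma / (1 + 2 * gamma)) ^+ 2 =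
    (ln L / L) `^ (2 * gamma / (1 + 2 * gamma)).
  by rewrite -powR_mulrn ?powR_ge0// -powRrM mulrAC [gamma * 2]mulrC.
rewrite re [leRHS]mulrDl lerD2r ler_wpM2l ?sqr_ge0//.
(* As ln L / L <= 1, the condition [gamma / (1 + 2 * gamma) <= delta] makes the Besov power no
   larger than the weak Besov one. *)
apply: ger_powR; first by rewrite r0 r1.
by rewrite -mulrA ler_pM2l.
Qed.
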